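(* The strict monoidal functor $(\mathbf Z/2\mathbf Z)_{\mathrm{disc}}\to\mathrm{Aut}(\Omega_{\mathrm{ns}})$ sending $0$ to the identity and $1$ to the mirror autoequivalence $M$ is an isomorphism of monoidal categories.
   Context: For a category $\mathcal C$, $\mathrm{Aut}(\mathcal C)$ is the category of autoequivalences of $\mathcal C$ (full subcategory, on the equivalences, of the category of endofunctors and natural transformations), with strict monoidal structure given by composition. $(\mathbf Z/2\mathbf Z)_{\mathrm{disc}}$ is the discrete category on the set $\mathbf Z/2\mathbf Z$, with strict monoidal structure given by the group law. $\mathrm{Op}_{\mathrm{ns}}$ is the category of small non-symmetric coloured operads in sets. A combinatorial tree is a non-empty finite connected graph with no loops (cycles); a vertex is outer if exactly one edge is attached to it. A tree is a combinatorial tree with a chosen outer vertex, the output, and a chosen (possibly empty) set of other outer vertices, the inputs. Its vertices are the vertices of the graph that are neither inputs nor the output; its edges are those of the graph. It is oriented from the inputs to the output, so each vertex has one output edge and a finite set of input edges. A planar tree is a tree with a linear ordering of the input edges of each vertex. For a planar tree $T$, $\Omega_{\mathrm{ns}}(T)$ is the free non-symmetric operad with colours the edges of $T$, generated by one operation $(e_1,\dots,e_m)\to e$ for each vertex with input edges $e_1<\dots<e_m$ and output edge $e$. The category $\Omega_{\mathrm{ns}}$ has as objects planar trees up to isomorphism and $\Omega_{\mathrm{ns}}(S,T)=\mathrm{Op}_{\mathrm{ns}}(\Omega_{\mathrm{ns}}(S),\Omega_{\mathrm{ns}}(T))$; it is a full subcategory of $\mathrm{Op}_{\mathrm{ns}}$.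 The mirror autoequivalence $M$ of $\mathrm{Op}_{\mathrm{ns}}$ keeps the colours and sets $M(P)(c_1,\dots,c_m;c)=P(c_m,\dots,c_1;c)$, with the evident action on maps; $M\circ M=\mathrm{id}$. It sends a planar tree to the planar tree obtained by reversing the orientation of the plane (reversing all the orderings), and hence induces the mirror autoequivalence $M$ of $\Omega_{\mathrm{ns}}$. *)

(* Defs.v *)
From mathcomp Require Import all_boot ssralg zmodp.
From mathcomp Require Import boolp.
Set Implicit Arguments. Unset Strict Implicit. Unset Printing Implicit Defensive.
Import GRing.Theory.

Lemma existT_inj (T : Type) (P : T -> Type) (x : T) (a b : P x) :
  existT P x a = existT P x b -> a = b.
Proof.
have key z : existT P x a = z ->
    exists p : x = projT1 z, ecast y (P y) p a = projT2 z.
  by move=> <-; exists erefl.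
by move=> /key[/= p]; rewrite (Prop_irrelevance p erefl).
Qed.

Record category := Category {
  obj :> Type;
  hom : obj -> obj -> Type;
  idm : forall x, hom x x;
  mcomp : forall x y z, hom y z -> hom x y -> hom x z;
  mcomp_idl : forall x y (f : hom x y), mcomp (idm y) f = f;
  mcomp_idr : forall x y (f : hom x y), mcomp f (idm x) = f;
  mcomp_assoc : forall x y z w (h : hom z w) (g : hom y z) (f : hom x y),
    mcomp h (mcomp g f) = mcomp (mcomp h g) f }.

Arguments idm {c} x.
Arguments mcomp {c x y z} _ _.

Definition are_inverse (C : category) (x y : C) (f : hom x y) (g : hom y x) : Prop :=
  mcomp g f = idm x /\ mcomp f g = idm y.

Definition is_isom (C : category) (x y : C) (f : hom x y) : Prop :=
  exists g : hom y x, are_inverse f g.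

(* A morphism bundled with its source and target, so that morphisms whose
   sources and targets are only propositionally equal can be compared. *)
Definition arr (C : category) (x y : C) (f : hom x y) : {xy : C * C & hom xy.1 xy.2} :=
  existT (fun xy : C * C => hom xy.1 xy.2) (x, y) f.

Record functor (C D : category) := Functor {
  fobj :> C -> D;
  fmor : forall x y, hom x y -> hom (fobj x) (fobj y);
  fmor_id : forall x, fmor (idm x) = idm (fobj x);
  fmor_comp : forall x y z (g : hom y z) (f : hom x y),
    fmor (mcomp g f) = mcomp (fmor g) (fmor f) }.

Arguments fmor {C D} _ {x y} _.

Definition functor_id (C : category) : functor C C :=
  @Functor C C id (fun _ _ => id) (fun _ => erefl) (fun _ _ _ _ _ => erefl).

Section FunctorComp.
Variables (C D E : category) (G : functor D E) (F : functor C D).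

Lemma functor_comp_id (x : C) : fmor G (fmor F (idm x)) = idm (G (F x)).
Proof. by rewrite !fmor_id. Qed.

Lemma functor_comp_comp (x y z : C) (g : hom y z) (f : hom x y) :
  fmor G (fmor F (mcomp g f)) = mcomp (fmor G (fmor F g)) (fmor G (fmor F f)).
Proof. by rewrite !fmor_comp. Qed.

Definition functor_comp : functor C E :=
  @Functor C E (fun x => G (F x)) (fun _ _ f => fmor G (fmor F f))
    functor_comp_id functor_comp_comp.
End FunctorComp.

Record nattrans (C D : category) (F G : functor C D) := NatTrans {
  ntcomp :> forall x, hom (F x) (G x);
  ntcomp_nat : forall x y (f : hom x y),
    mcomp (ntcomp y) (fmor F f) = mcomp (fmor G f) (ntcomp x) }.

Lemma nattrans_eq (C D : category) (F G : functor C D) (a b : nattrans F G) :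
  (forall x, a x = b x) -> a = b.
Proof.
case: a b => [a na] [b nb] /= ab.
have e : a = b by apply: functional_extensionality_dep.
by move: na nb; rewrite e => na nb; congr NatTrans; apply: Prop_irrelevance.
Qed.

Definition naturally_isomorphic (C D : category) (F G : functor C D) : Prop :=
  exists a : nattrans F G, forall x, is_isom (a x).

Definition is_equivalence (C D : category) (F : functor C D) : Prop :=
  exists G : functor D C,
    naturally_isomorphic (functor_comp G F) (functor_id C) /\
    naturally_isomorphic (functor_comp F G) (functor_id D).

Section EndCategory.
Variables C D : category.

Definition nt_id (F : functor C D) : nattrans F F.
Proof.
by exists (fun x => idm (F x)) => x y f; rewrite mcomp_idl mcomp_idr.
Defined.

Definition nt_comp (F G H : functor C D) (b : nattrans G H) (a : nattrans F G) :
  nattrans F H.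
Proof.
exists (fun x => mcomp (b x) (a x)) => x y f /=.
by rewrite -mcomp_assoc (ntcomp_nat a f) mcomp_assoc (ntcomp_nat b f) mcomp_assoc.
Defined.

Definition functor_cat : category.
Proof.
refine (@Category (functor C D) (@nattrans C D) nt_id nt_comp _ _ _).
- by move=> F G a; apply: nattrans_eq => x /=; apply: mcomp_idl.
- by move=> F G a; apply: nattrans_eq => x /=; apply: mcomp_idr.
- by move=> F G H K c b a; apply: nattrans_eq => x /=; apply: mcomp_assoc.
Defined.
End EndCategory.

Definition nt_hcomp (C D E : category) (G G' : functor D E) (F F' : functor C D)
    (b : nattrans G G') (a : nattrans F F') :
  nattrans (functor_comp G F) (functor_comp G' F').
Proof.
exists (fun x => mcomp (b (F' x)) (fmor G (a x))) => x y f /=.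
rewrite -mcomp_assoc -fmor_comp (ntcomp_nat a f) fmor_comp mcomp_assoc.
by rewrite (ntcomp_nat b (fmor F' f)) mcomp_assoc.
Defined.

(* Category whose objects are names [x : X] of objects [i x] of [C]; the full
   subcategory on [X] when [i] is injective. *)
Definition full_cat (C : category) (X : Type) (i : X -> C) : category :=
  @Category X (fun x y => hom (i x) (i y)) (fun x => idm (i x))
    (fun x y z => @mcomp C (i x) (i y) (i z))
    (fun x y => @mcomp_idl C (i x) (i y)) (fun x y => @mcomp_idr C (i x) (i y))
    (fun x y z w => @mcomp_assoc C (i x) (i y) (i z) (i w)).

Definition full_subcat (C : category) (S : C -> Prop) : category :=
  full_cat (fun x : {x : C | S x} => sval x).

Section RestrictFunctor.
Variables (C : category) (X : Type) (i : X -> C) (F : functor C C) (m : X -> X).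
Variables (u : forall x, hom (F (i x)) (i (m x))) (v : forall x, hom (i (m x)) (F (i x))).
Hypothesis uv : forall x, are_inverse (u x) (v x).

(* The functor induced by [F] on [full_cat i], given isomorphisms
   [F (i x) ~ i (m x)]. *)
Definition induced_functor : functor (full_cat i) (full_cat i).
Proof.
refine (@Functor (full_cat i) (full_cat i) m
  (fun x y f => mcomp (u y) (mcomp (fmor F (f : @hom C (i x) (i y))) (v x))) _ _).
- by move=> x /=; rewrite fmor_id mcomp_idl; case: (uv x).
- move=> x y z g f /=; rewrite fmor_comp -!mcomp_assoc; congr mcomp.
  congr mcomp; rewrite [in RHS]mcomp_assoc; case: (uv y) => -> _.
  by rewrite mcomp_idl.
Defined.
End RestrictFunctor.

Record strict_monoidal_category := StrictMonoidalCategory {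
  smcat :> category;
  tunit : smcat;
  ten : smcat -> smcat -> smcat;
  tenm : forall x x' y y' : smcat, hom x x' -> hom y y' -> hom (ten x y) (ten x' y');
  tenm_id : forall x y, tenm (idm x) (idm y) = idm (ten x y);
  tenm_comp : forall x x' x'' y y' y''
      (f' : hom x' x'') (f : hom x x') (g' : hom y' y'') (g : hom y y'),
    tenm (mcomp f' f) (mcomp g' g) = mcomp (tenm f' g') (tenm f g);
  ten_unitl : forall x, ten tunit x = x;
  ten_unitr : forall x, ten x tunit = x;
  ten_assoc : forall x y z, ten x (ten y z) = ten (ten x y) z;
  tenm_unitl : forall x x' (f : hom x x'), arr (tenm (idm tunit) f) = arr f;
  tenm_unitr : forall x x' (f : hom x x'), arr (tenm f (idm tunit)) = arr f;
  tenm_assoc : forall x x' y y' z z' (f : hom x x') (g : hom y y') (h : hom z z'),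
    arr (tenm f (tenm g h)) = arr (tenm (tenm f g) h) }.

Arguments tunit {s}.
Arguments ten {s} x y.
Arguments tenm {s x x' y y'} f g.

Record strict_monoidal_functor (A B : strict_monoidal_category) := StrictMonoidalFunctor {
  smfun :> functor A B;
  smfun_unit : smfun tunit = tunit;
  smfun_ten : forall x y, smfun (ten x y) = ten (smfun x) (smfun y);
  smfun_tenm : forall x x' y y' (f : hom x x') (g : hom y y'),
    arr (fmor smfun (tenm f g)) = arr (tenm (fmor smfun f) (fmor smfun g)) }.

Definition is_monoidal_isomorphism (A B : strict_monoidal_category)
    (F : strict_monoidal_functor A B) : Prop :=
  exists G : strict_monoidal_functor B A,
    functor_comp G F = functor_id A /\ functor_comp F G = functor_id B.

Section FullMonoidal.
Variables (A : strict_monoidal_category) (S : A -> Prop).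
Hypotheses (S1 : S tunit) (ST : forall x y, S x -> S y -> S (ten x y)).
Let B := full_subcat S.

Lemma full_arr_eq (x y x' y' : B) (f : hom x y) (g : hom x' y') :
  arr (f : @hom A (sval x) (sval y)) = arr (g : @hom A (sval x') (sval y')) ->
  arr f = arr g.
Proof.
case: x y x' y' f g => [x hx] [y hy] [x' hx'] [y' hy'] /= f g e.
have [ex ey] : x = x' /\ y = y'.
  by have := congr1 (fun z => projT1 z) e => /= -[].
move: hx' hy' g e; rewrite -{}ex -{}ey => hx' hy' g e.
rewrite (Prop_irrelevance hx' hx) (Prop_irrelevance hy' hy).
by rewrite (existT_inj e : f = g).
Qed.

Lemma full_obj_eq (x y : B) : sval x = sval y -> x = y.
Proof. by case: x y => [x hx] [y hy]; apply: eq_exist. Qed.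

(* Full monoidal subcategory on a class of objects containing the unit and
   closed under tensor products. *)
Definition full_monoidal_subcat : strict_monoidal_category.
Proof.
refine (@StrictMonoidalCategory B (exist _ tunit S1)
  (fun x y => exist _ (ten (sval x) (sval y)) (ST (svalP x) (svalP y)))
  (fun x x' y y' f g => @tenm A (sval x) (sval x') (sval y) (sval y') f g)
  _ _ _ _ _ _ _ _).
- by move=> x y; apply: (@tenm_id A).
- by move=> *; apply: (@tenm_comp A).
- by move=> x; apply: full_obj_eq; apply: ten_unitl.
- by move=> x; apply: full_obj_eq; apply: ten_unitr.
- by move=> x y z; apply: full_obj_eq; apply: ten_assoc.
- by move=> *; apply: full_arr_eq; apply: (@tenm_unitl A).
- by move=> *; apply: full_arr_eq; apply: (@tenm_unitr A).
- by move=> *; apply: full_arr_eq; apply: (@tenm_assoc A).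
Defined.
End FullMonoidal.

Section Aut.
Variable C : category.

Lemma functor_eq (D : category) (F G : functor C D) (e : fobj F = fobj G) :
  (forall x y (f : hom x y), arr (fmor F f) = arr (fmor G f)) -> F = G.
Proof.
case: F G e => [F mF iF cF] [G mG iG cG] /= e.
move: mG iG cG; rewrite -{}e => mG iG cG /= em.
have {em}em : mF = mG.
  apply: functional_extensionality_dep => x.
  apply: functional_extensionality_dep => y.
  apply: funext => f; exact: (existT_inj (em x y f)).
move: iF cF iG cG; rewrite {}em => *; congr Functor; exact: Prop_irrelevance.
Qed.

Lemma nt_arr_eq (F G F' G' : functor C C) (a : nattrans F G) (b : nattrans F' G')
    (eF : F = F') (eG : G = G') :
  (forall x, arr (a x) = arr (b x)) ->
  @arr (functor_cat C C) F G a = @arr (functor_cat C C) F' G' b.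
Proof.
case: _ / eF b; case: _ / eG => b ab.
suff -> : a = b by [].
by apply: nattrans_eq => x; apply: (existT_inj (ab x)).
Qed.

(* Endofunctors of [C]: the tensor product is composition on objects, and
   horizontal composition on natural transformations. *)
Definition end_cat : strict_monoidal_category.
Proof.
refine (@StrictMonoidalCategory (functor_cat C C) (functor_id C)
  (@functor_comp C C C)
  (fun F F' G G' a b => nt_hcomp a b) _ _ _ _ _ _ _ _).
- by move=> F G; apply: nattrans_eq => x /=; rewrite fmor_id mcomp_idl.
- move=> F F' F'' G G' G'' a' a b' b; apply: nattrans_eq => x /=.
  rewrite fmor_comp -!mcomp_assoc; congr mcomp; rewrite !mcomp_assoc.
  by rewrite (ntcomp_nat a (b' x)).
- by move=> F; apply: functor_eq.
- by move=> F; apply: functor_eq.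
- by move=> F G H; apply: functor_eq.
- move=> F F' a; apply: nt_arr_eq; try exact: functor_eq.
  by move=> x /=; rewrite mcomp_idl.
- move=> F F' a; apply: nt_arr_eq; try exact: functor_eq.
  by move=> x /=; rewrite fmor_id mcomp_idr.
- move=> F F' G G' H H' a b c; apply: nt_arr_eq; try exact: functor_eq.
  by move=> x /=; rewrite fmor_comp mcomp_assoc.
Defined.

Lemma nat_iso_refl (D : category) (F : functor C D) : naturally_isomorphic F F.
Proof.
exists (nt_id F) => x; exists (idm (F x)).
by split; rewrite /= mcomp_idl.
Qed.

Lemma is_equivalence_id : is_equivalence (functor_id C).
Proof.
exists (functor_id C); split; rewrite (_ : functor_comp _ _ = functor_id C);
  by [apply: nat_iso_refl | apply: functor_eq].
Qed.
End Aut.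

Lemma fmor_isom (C D : category) (F : functor C D) (x y : C) (f : hom x y) :
  is_isom f -> is_isom (fmor F f).
Proof.
by case=> g [gf fg]; exists (fmor F g); split; rewrite -fmor_comp ?gf ?fg fmor_id.
Qed.

Lemma mcomp_isom (C : category) (x y z : C) (g : hom y z) (f : hom x y) :
  is_isom g -> is_isom f -> is_isom (mcomp g f).
Proof.
case=> g' [g'g gg'] [f' [f'f ff']]; exists (mcomp f' g'); split.
  by rewrite mcomp_assoc -(mcomp_assoc f') g'g mcomp_idr.
by rewrite mcomp_assoc -(mcomp_assoc g) ff' mcomp_idr.
Qed.

Lemma idm_isom (C : category) (x : C) : is_isom (idm x).
Proof. by exists (idm x); split; rewrite mcomp_idl. Qed.

Lemma nat_iso_trans (C D : category) (F G H : functor C D) :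
  naturally_isomorphic F G -> naturally_isomorphic G H -> naturally_isomorphic F H.
Proof.
move=> [a ia] [b ib]; exists (nt_comp b a) => x; exact: mcomp_isom.
Qed.

Lemma nat_iso_hcomp (C D E : category) (G G' : functor D E) (F F' : functor C D) :
  naturally_isomorphic G G' -> naturally_isomorphic F F' ->
  naturally_isomorphic (functor_comp G F) (functor_comp G' F').
Proof.
move=> [b ib] [a ia]; exists (nt_hcomp b a) => x; apply: mcomp_isom => //.
exact: fmor_isom.
Qed.

Lemma functor_compA (C D E X : category) (H : functor E X) (G : functor D E)
    (F : functor C D) :
  functor_comp H (functor_comp G F) = functor_comp (functor_comp H G) F.
Proof. exact: functor_eq. Qed.

Lemma functor_comp1F (C D : category) (F : functor C D) :
  functor_comp (functor_id D) F = F.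
Proof. exact: functor_eq. Qed.

Lemma is_equivalence_comp (C : category) (G F : functor C C) :
  is_equivalence G -> is_equivalence F -> is_equivalence (functor_comp G F).
Proof.
have key (A B A' B' : functor C C) :
    naturally_isomorphic (functor_comp A' A) (functor_id C) ->
    naturally_isomorphic (functor_comp B' B) (functor_id C) ->
    naturally_isomorphic (functor_comp (functor_comp B' A') (functor_comp A B))
      (functor_id C).
  move=> iA iB; apply: nat_iso_trans iB.
  rewrite -(functor_compA B') (functor_compA A') -[X in naturally_isomorphic _ (functor_comp _ X)]functor_comp1F.
  by apply: nat_iso_hcomp (nat_iso_refl _) _; apply: nat_iso_hcomp iA (nat_iso_refl _).
move=> [G' [G'G GG']] [F' [F'F FF']]; exists (functor_comp F' G').
by split; apply: key.
Qed.

(* Autoequivalences of [C], with composition as tensor product. *)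
Definition Aut (C : category) : strict_monoidal_category :=
  @full_monoidal_subcat (end_cat C) (@is_equivalence C C)
    (@is_equivalence_id C) (@is_equivalence_comp C).

Definition underlying_functor (C : category) (F : Aut C) : functor C C := sval F.

(* The discrete category on an abelian group, with the group law as tensor
   product. *)
Section Discrete.
Variable G : zmodType.
Local Open Scope ring_scope.

Definition disc_cat : category :=
  @Category G (fun x y => x = y) (fun x => erefl) (fun x y z g f => etrans f g)
    (fun _ _ _ => Prop_irrelevance _ _) (fun _ _ _ => Prop_irrelevance _ _)
    (fun _ _ _ _ _ _ _ => Prop_irrelevance _ _).

Lemma disc_arr_eq (x y x' y' : disc_cat) (f : hom x y) (g : hom x' y') :
  x = x' -> arr f = arr g.
Proof. by move=> e; move: (f) (g); rewrite -f -g -e => f1 g1; rewrite (Prop_irrelevance (f1 : x = x :> G) g1). Qed.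

Definition disc_monoidal : strict_monoidal_category.
Proof.
refine (@StrictMonoidalCategory disc_cat (0 : G) (fun x y => x + y : G)
  (fun x x' y y' (f : x = x') (g : y = y') => congr2 +%R f g) _ _ _ _ _ _ _ _).
- by move=> x y /=; apply: (@Prop_irrelevance (x + y = x + y :> G)).
- by move=> x x' x'' y y' y'' *; apply: (@Prop_irrelevance (x + y = x'' + y'' :> G)).
- exact: add0r.
- exact: addr0.
- exact: addrA.
- by move=> *; apply: disc_arr_eq; rewrite /= add0r.
- by move=> *; apply: disc_arr_eq; rewrite /= addr0.
- by move=> *; apply: disc_arr_eq; rewrite /= addrA.
Defined.
End Discrete.

(* [forest P s t] consists of one operation of [P] for each entry [c] of [t],
   with output [c], the concatenation of the inputs being [s]. *)
Inductive forest (C : Type) (P : seq C -> C -> Type) : seq C -> seq C -> Type :=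
| fnil : forest P [::] [::]
| fcons a c b t : P a c -> forest P b t -> forest P (a ++ b) (c :: t).

Arguments fnil {C P}.
Arguments fcons {C P a c b t} _ _.

Section Forest.
Variables (C : Type) (P : seq C -> C -> Type).

(* Transport along equalities of the lists of inputs or outputs. *)
Definition castop s s' c (e : s = s') (x : P s c) : P s' c := ecast i (P i c) e x.

Definition castf s s' t t' (es : s = s') (et : t = t') (x : forest P s t) :
  forest P s' t' := ecast i (forest P i t') es (ecast j (forest P s j) et x).

Inductive uncons_forest (c : C) (t : seq C) : seq C -> Type :=
| UnconsForest a b : P a c -> forest P b t -> uncons_forest c t (a ++ b).

Definition funcons s c t (f : forest P s (c :: t)) : uncons_forest c t s :=
  match f in forest _ s t'
    return (if t' is c' :: t'' then uncons_forest c' t'' s else unit) with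
  | fnil => tt
  | fcons a c b t x f' => UnconsForest x f'
  end.

Inductive split_forest (a b : seq C) : seq C -> Type :=
| SplitForest r1 r2 : forest P r1 a -> forest P r2 b -> split_forest a b (r1 ++ r2).

Fixpoint fsplit a b : forall r, forest P r (a ++ b) -> split_forest a b r :=
  match a return forall r, forest P r (a ++ b) -> split_forest a b r with
  | [::] => fun r f => SplitForest fnil f
  | c :: a' => fun r f =>
      match funcons f in uncons_forest _ _ r return split_forest (c :: a') b r with
      | UnconsForest x y p f' =>
          match fsplit f' in split_forest _ _ y
            return split_forest (c :: a') b (x ++ y) with
          | SplitForest r1 r2 f1 f2 =>
              ecast i (split_forest (c :: a') b i) (esym (catA x r1 r2))
                (SplitForest (fcons p f1) f2)
          end
      end
  end.

(* A single operation, as a forest. *)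
Definition fone s c (x : P s c) : forest P s [:: c] :=
  castf (cats0 s) erefl (fcons x fnil).

Fixpoint fcat a b r1 r2 (f1 : forest P r1 a) : forest P r2 b -> forest P (r1 ++ r2) (a ++ b) :=
  match f1 in forest _ r1 a return forest P r2 b -> forest P (r1 ++ r2) (a ++ b) with
  | fnil => id
  | fcons x c y t p f1' => fun f2 =>
      castf (catA x y r2) erefl (fcons p (fcat f1' f2))
  end.

(* The forest of units. *)
Definition fids (u : forall c, P [:: c] c) : forall s, forest P s s :=
  fix ids s := match s return forest P s s with
  | [::] => fnil
  | c :: s' => @fcons _ _ [:: c] c s' s' (u c) (ids s')
  end.
End Forest.

(* Composition of forests: each operation of [us] is composed with the block of
   operations of [f] that are plugged into its inputs. *)
Definition fcomp (C : Type) (P Q R : seq C -> C -> Type)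
  (comp : forall t c, P t c -> forall s, forest Q s t -> R s c) :=
  fix fc s t (us : forest P s t) : forall r, forest Q r s -> forest R r t :=
  match us in forest _ s t return forall r, forest Q r s -> forest R r t with
  | fnil => fun r f =>
      match f in forest _ r s return (if s is [::] then forest R r [::] else unit) with
      | fnil => fnil | fcons _ _ _ _ _ _ => tt end
  | fcons a c b t u us' => fun r f =>
      match fsplit f in split_forest _ _ _ r return forest R r (c :: t) with
      | SplitForest r1 r2 f1 f2 => fcons (comp a c u r1 f1) (fc b t us' r2 f2)
      end
  end.

(* Entrywise application of a map of operations over the map [h] of colours. *)
Definition fmap (C D : Type) (P : seq C -> C -> Type) (Q : seq D -> D -> Type)
  (h : C -> D) (m : forall s c, P s c -> Q (map h s) (h c)) :=
  fix fm s t (us : forest P s t) : forest Q (map h s) (map h t) :=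
  match us in forest _ s t return forest Q (map h s) (map h t) with
  | fnil => fnil
  | fcons a c b t u us' =>
      castf (esym (map_cat h a b)) erefl (fcons (m a c u) (fm b t us'))
  end.

(* Non-symmetric coloured operads: [op s c] is the set of operations with list of
   inputs [s] and output [c], and [op_comp] is the composition
   [P(c_1, ..., c_m; c) * P(s_1; c_1) * ... * P(s_m; c_m) -> P(s_1 ++ ... ++ s_m; c)]. *)
Record operad := Operad {
  colour : Type;
  op : seq colour -> colour -> Type;
  op_id : forall c, op [:: c] c;
  op_comp : forall t c, op t c -> forall s, forest op s t -> op s c;
  op_idl : forall s c (p : op s c), op_comp (op_id c) (fone p) = p;
  op_idr : forall s c (p : op s c), op_comp p (fids op_id s) = p;
  op_assoc : forall t c (p : op t c) s (q : forest op s t) r (w : forest op r s),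
    op_comp (op_comp p q) w = op_comp p (fcomp op_comp q w) }.

Arguments op_id {o} c.
Arguments op_comp {o t c} _ {s} _.

Record operad_map (P Q : operad) := OperadMap {
  cmap :> colour P -> colour Q;
  omap : forall s c, @op P s c -> @op Q (map cmap s) (cmap c);
  omap_id : forall c, omap (op_id c) = op_id (cmap c);
  omap_comp : forall t c (p : @op P t c) s (q : forest (@op P) s t),
    omap (op_comp p q) = op_comp (omap p) (fmap omap q) }.

Arguments omap {P Q} _ {s c} _.

Section ForestTheory.
Variables (C : Type).
Implicit Types (P Q R : seq C -> C -> Type).

(* An operation bundled with its inputs and output. *)
Definition tot P s c (x : P s c) : {i : seq C * C & P i.1 i.2} :=
  existT (fun i : seq C * C => P i.1 i.2) (s, c) x.

Lemma tot_inj P s c (x y : P s c) : tot x = tot y -> x = y.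
Proof. exact: existT_inj. Qed.

Arguments tot_inj {P s c x y} _.

Lemma tot_castop P s s' c (e : s = s') (x : P s c) : tot (castop e x) = tot x.
Proof. by case: _ / e. Qed.

Lemma castop_tot P s s' c (e : s = s') (x : P s c) (y : P s' c) :
  tot x = tot y -> castop e x = y.
Proof. by move=> h; apply: tot_inj; rewrite tot_castop. Qed.

Definition totf P s t (x : forest P s t) : {i : seq C * seq C & forest P i.1 i.2} :=
  existT (fun i : seq C * seq C => forest P i.1 i.2) (s, t) x.

Lemma totf_inj P s t (x y : forest P s t) : totf x = totf y -> x = y.
Proof. exact: existT_inj. Qed.

Arguments totf_inj {P s t x y} _.

Lemma totf_cast P s s' t t' (es : s = s') (et : t = t') (x : forest P s t) :
  totf (castf es et x) = totf x.
Proof. by case: _ / es; case: _ / et. Qed.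

Lemma totfP P s t s' t' (x : forest P s t) (y : forest P s' t') : totf x = totf y ->
  exists (es : s = s') (et : t = t'), y = castf es et x.
Proof.
move=> e; have [es et] : s = s' /\ t = t' by have := congr1 (@projT1 _ _) e; case.
exists es, et; apply: totf_inj; by rewrite totf_cast.
Qed.

Arguments totfP {P s t s' t' x y} _.

Lemma totP P s c s' c' (x : P s c) (y : P s' c') : tot x = tot y ->
  exists (es : s = s') (ec : c = c'), y = ecast j (P s' j) ec (castop es x).
Proof.
move=> e; have [es ec] : s = s' /\ c = c' by have := congr1 (@projT1 _ _) e; case.
exists es, ec; move: x y e; case: _ / es; case: _ / ec => x y /tot_inj -> //.
Qed.

Arguments totP {P s c s' c' x y} _.

Lemma totf_cons P a a' c c' b b' t t' (x : P a c) (x' : P a' c')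
    (y : forest P b t) (y' : forest P b' t') :
  tot x = tot x' -> totf y = totf y' -> totf (fcons x y) = totf (fcons x' y').
Proof.
move=> /totP [ea [ec ->]] /totfP [eb [et ->]].
by case: _ / ea; case: _ / ec; case: _ / eb; case: _ / et.
Qed.

Lemma totf_cat P a a' b b' r1 r1' r2 r2' (x : forest P r1 a) (x' : forest P r1' a')
    (y : forest P r2 b) (y' : forest P r2' b') :
  totf x = totf x' -> totf y = totf y' -> totf (fcat x y) = totf (fcat x' y').
Proof.
move=> /totfP [ea [ec ->]] /totfP [eb [et ->]].
by case: _ / ea; case: _ / ec; case: _ / eb; case: _ / et.
Qed.

Lemma totf_one P s c s' c' (x : P s c) (x' : P s' c') :
  tot x = tot x' -> totf (fone x) = totf (fone x').
Proof. by move=> e; rewrite !totf_cast; apply: totf_cons. Qed.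

Lemma totf_nil P s (x : forest P s [::]) : totf x = totf (@fnil C P).
Proof.
have: forall t (y : forest P s t), t = [::] -> totf y = totf fnil.
  by move=> t y; case: y.
by apply.
Qed.

Lemma fconsP P s c t (f : forest P s (c :: t)) :
  exists a b (x : P a c) (f' : forest P b t), totf f = totf (fcons x f').
Proof.
have: forall u (y : forest P s u), u = c :: t ->
    exists a b (x : P a c) (f' : forest P b t), totf y = totf (fcons x f').
  by move=> u; case=> // a c' b t' x f' [<- <-]; exists a, b, x, f'.
exact.
Qed.

Lemma totf_catA P a b c r1 r2 r3 (x : forest P r1 a) (y : forest P r2 b)
    (z : forest P r3 c) :
  totf (fcat x (fcat y z)) = totf (fcat (fcat x y) z).
Proof.
elim: x => //= {r1 a} a0 c0 b0 t0 p f IH; rewrite totf_cast.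
transitivity (totf (fcat (fcons p (fcat f y)) z)); last first.
  apply: (@totf_cat P (c0 :: t0 ++ b) (c0 :: t0 ++ b) c c) => //.
  by rewrite totf_cast.
by rewrite /= totf_cast; apply: totf_cons.
Qed.

Lemma totf_cat0 P a r (x : forest P r a) : totf (fcat x fnil) = totf x.
Proof. by elim: x => //= *; rewrite totf_cast; apply: totf_cons. Qed.

Lemma fcons_one P a c b t (x : P a c) (f : forest P b t) :
  totf (fcons x f) = totf (fcat (fone x) f).
Proof.
transitivity (totf (fcat (fcons x fnil) f)); first by rewrite /= totf_cast.
by apply: totf_cat => //; rewrite totf_cast.
Qed.

Lemma fsplit_cat P a b r1 r2 (x : forest P r1 a) (y : forest P r2 b) :
  fsplit (fcat x y) = SplitForest x y.
Proof.
elim: x => //= {r1 a} a c b0 t p f IH.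
suff H u (e : u = a ++ (b0 ++ r2)) g : totf g = totf (fcons p (fcat f y)) ->
   forall e' : u = (a ++ b0) ++ r2,
   match funcons g in uncons_forest _ _ _ r return split_forest P (c :: t) b r with
      | UnconsForest x y p f' =>
          match fsplit f' in split_forest _ _ _ y
            return split_forest P (c :: t) b (x ++ y) with
          | SplitForest r1 r2 f1 f2 =>
              ecast i (split_forest P (c :: t) b i) (esym (catA x r1 r2))
                (SplitForest (fcons p f1) f2)
          end
      end = ecast i (split_forest P (c :: t) b i) (esym e') (SplitForest (fcons p f) y).
  have := H _ (esym (catA _ _ _)) _ (totf_cast (catA _ _ _) erefl _) erefl.
  exact.
move: g; rewrite {u}e => g /totf_inj -> e' /=.
by rewrite IH (Prop_irrelevance e' (catA a b0 r2)).
Qed.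

Lemma fcatP P a b r (f : forest P r (a ++ b)) :
  exists r1 r2 (x : forest P r1 a) (y : forest P r2 b), totf f = totf (fcat x y).
Proof.
elim: a r f => [|c a IH] r f; first by exists [::], r, fnil, f.
have [a1 [b1 [x [f' e]]]] := fconsP f.
have [r1 [r2 [f1 [f2 e']]]] := IH _ f'.
exists (a1 ++ r1), r2, (fcons x f1), f2.
by rewrite /= totf_cast e; apply: totf_cons.
Qed.

Lemma fcat_ind P a b (K : forall r, forest P r (a ++ b) -> Prop) :
  (forall r1 r2 (x : forest P r1 a) (y : forest P r2 b), K _ (fcat x y)) ->
  forall r (f : forest P r (a ++ b)), K r f.
Proof.
move=> h r f; have [r1 [r2 [x [y /esym/totfP[e1 [e2 ->]]]]]] := fcatP f.
by case: _ / e1; rewrite (Prop_irrelevance e2 erefl); apply: h.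
Qed.

Lemma fcons_ind P c t (K : forall r, forest P r (c :: t) -> Prop) :
  (forall a b (x : P a c) (y : forest P b t), K _ (fcons x y)) ->
  forall r (f : forest P r (c :: t)), K r f.
Proof.
move=> h r f; have [a [b [x [y /esym/totfP[e1 [e2 ->]]]]]] := fconsP f.
by case: _ / e1; rewrite (Prop_irrelevance e2 erefl); apply: h.
Qed.

Lemma fnil_ind P (K : forall r, forest P r [::] -> Prop) :
  K _ fnil -> forall r (f : forest P r [::]), K r f.
Proof.
move=> h r f; have /esym/totfP[e1 [e2 ->]] := totf_nil f.
by case: _ / e1; rewrite (Prop_irrelevance e2 erefl).
Qed.

Lemma fone_ind P c (K : forall r, forest P r [:: c] -> Prop) :
  (forall s (x : P s c), K _ (fone x)) -> forall r (f : forest P r [:: c]), K r f.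
Proof.
move=> h; apply: fcons_ind => a b x.
apply: (@fnil_ind P (fun b y => K (a ++ b) (fcons x y))) b.
have: totf (fone x) = totf (fcons x fnil) by rewrite totf_cast.
move=> /totfP[e1 [e2 ->]]; move: e1; rewrite (Prop_irrelevance e2 erefl) => e1.
by case: _ / e1 (h a x).
Qed.

Section Comp.
Variables (P Q R : seq C -> C -> Type).
Variable comp : forall t c, P t c -> forall s, forest Q s t -> R s c.

Lemma fcomp_cons a c b t r1 r2 (u : P a c) (us : forest P b t)
    (x : forest Q r1 a) (y : forest Q r2 b) :
  fcomp comp (fcons u us) (fcat x y) = fcons (comp u x) (fcomp comp us y).
Proof. by rewrite /= fsplit_cat. Qed.

Lemma totf_fcomp s t r s' t' r' (us : forest P s t) (us' : forest P s' t')
    (w : forest Q r s) (w' : forest Q r' s') :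
  totf us = totf us' -> totf w = totf w' ->
  totf (fcomp comp us w) = totf (fcomp comp us' w').
Proof.
move=> /totfP[es [et ->]]; case: _ / es w'; case: _ / et => w' /totfP[er [es ->]].
by case: _ / er; rewrite (Prop_irrelevance es erefl).
Qed.

Lemma totf_fcomp_cat a b s1 s2 r1 r2 (us : forest P s1 a) (vs : forest P s2 b)
    (x : forest Q r1 s1) (y : forest Q r2 s2) :
  totf (fcomp comp (fcat us vs) (fcat x y)) =
  totf (fcat (fcomp comp us x) (fcomp comp vs y)).
Proof.
elim: us r1 x => {s1 a} [|a0 c0 b0 t0 p f IH] r1 x.
  by move: r1 x; apply: fnil_ind.
elim/fcat_ind: r1 / x => r1 r2' x1 x2.
transitivity (totf (fcomp comp (fcons p (fcat f vs)) (fcat x1 (fcat x2 y)))).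
  by apply: totf_fcomp; rewrite ?totf_catA // totf_cast.
rewrite !fcomp_cons [in RHS]/= totf_cast.
exact: totf_cons.
Qed.

Lemma totf_fcomp_one s c r (u : P s c) (x : forest Q r s) :
  totf (fcomp comp (fone u) x) = totf (fone (comp u x)).
Proof.
transitivity (totf (fcomp comp (fcons u fnil) (fcat x fnil))).
  by apply: totf_fcomp; rewrite ?totf_cat0 // totf_cast.
by rewrite fcomp_cons totf_cast.
Qed.
End Comp.

Fixpoint fAll P (K : forall s c, P s c -> Prop) s t (f : forest P s t) : Prop :=
  match f with
  | fnil => True
  | fcons a c b t u us => K a c u /\ fAll K us
  end.

Lemma fAllT P (K : forall s c, P s c -> Prop) s t (f : forest P s t) :
  (forall s c x, K s c x) -> fAll K f.
Proof. by move=> k; elim: f => //= *; split. Qed.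

Lemma fcomp_assoc (P Q R PQ QR S : seq C -> C -> Type)
  (pq : forall t c, P t c -> forall s, forest Q s t -> PQ s c)
  (qr : forall t c, Q t c -> forall s, forest R s t -> QR s c)
  (pq_r : forall t c, PQ t c -> forall s, forest R s t -> S s c)
  (p_qr : forall t c, P t c -> forall s, forest QR s t -> S s c)
  t u (p : forest P t u) :
  fAll (fun t c p => forall s (q : forest Q s t) r (w : forest R r s),
    pq_r _ _ (pq _ _ p _ q) _ w = p_qr _ _ p _ (fcomp qr q w)) p ->
  forall s (q : forest Q s t) r (w : forest R r s),
    fcomp pq_r (fcomp pq p q) w = fcomp p_qr p (fcomp qr q w).
Proof.
elim: p => {t u} [|a c b t p ps IH] h s q r w.
  elim/fnil_ind: s / q w => w.
  by elim/fnil_ind: r / w.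
case: h => h /IH {}IH.
elim/fcat_ind: s / q w => s1 s2 q1 q2 w.
elim/fcat_ind: r / w => r1 r2 w1 w2.
apply: totf_inj; rewrite !fcomp_cons h IH.
transitivity (totf (fcomp p_qr (fcons p ps) (fcat (fcomp qr q1 w1) (fcomp qr q2 w2)))).
  by rewrite fcomp_cons.
by apply: totf_fcomp; rewrite // totf_fcomp_cat.
Qed.

End ForestTheory.

Arguments tot_inj {C P s c x y} _.
Arguments totf_inj {C P s t x y} _.
Arguments totP {C P s c s' c' x y} _.
Arguments totfP {C P s t s' t' x y} _.

Section FmapTheory.
Variables (C D : Type) (P : seq C -> C -> Type) (Q : seq D -> D -> Type).
Variable h : C -> D.

Section One.
Variable m : forall s c, P s c -> Q (map h s) (h c).

Lemma totf_fmap s t s' t' (x : forest P s t) (y : forest P s' t') :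
  totf x = totf y -> totf (fmap m x) = totf (fmap m y).
Proof. by move=> /totfP[es [et ->]]; case: _ / es; case: _ / et. Qed.

Lemma totm s c s' c' (x : P s c) (y : P s' c') :
  tot x = tot y -> tot (m x) = tot (m y).
Proof. by move=> /totP[es [et ->]]; case: _ / es; case: _ / et. Qed.

Lemma totf_fmap_cons a c b t (x : P a c) (y : forest P b t) :
  totf (fmap m (fcons x y)) = totf (fcons (m x) (fmap m y)).
Proof. by rewrite totf_cast. Qed.

Lemma totf_fmap_cat a b r1 r2 (x : forest P r1 a) (y : forest P r2 b) :
  totf (fmap m (fcat x y)) = totf (fcat (fmap m x) (fmap m y)).
Proof.
elim: x => {r1 a} [|r1 c b1 a u us IH] //.
transitivity (totf (fmap m (fcons u (fcat us y)))).
  by apply: totf_fmap; rewrite /= totf_cast.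
rewrite totf_fmap_cons.
transitivity (totf (fcat (fcons (m u) (fmap m us)) (fmap m y))).
  by rewrite /= totf_cast; apply: totf_cons.
by apply: (@totf_cat _ _ (h c :: map h a) (h c :: map h a)); rewrite ?totf_fmap_cons.
Qed.

Lemma totf_fmap_one s c (x : P s c) : totf (fmap m (fone x)) = totf (fone (m x)).
Proof.
transitivity (totf (fmap m (fcons x fnil))); first by apply: totf_fmap; rewrite totf_cast.
by rewrite totf_fmap_cons totf_cast.
Qed.
End One.

Lemma fmap_eq (m m' : forall s c, P s c -> Q (map h s) (h c)) s t (x : forest P s t) :
  fAll (fun s c x => m s c x = m' s c x) x -> fmap m x = fmap m' x.
Proof. by elim: x => //= a c b t0 u us IH [-> /IH ->]. Qed.
End FmapTheory.

Lemma totf_fmap_comp (C D : Type) (h : C -> D)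
    (P Q R : seq C -> C -> Type) (P' Q' R' : seq D -> D -> Type)
    (comp : forall t c, P t c -> forall s, forest Q s t -> R s c)
    (comp' : forall t c, P' t c -> forall s, forest Q' s t -> R' s c)
    (mP : forall s c, P s c -> P' (map h s) (h c))
    (mQ : forall s c, Q s c -> Q' (map h s) (h c))
    (mR : forall s c, R s c -> R' (map h s) (h c))
    s t (us : forest P s t) :
  fAll (fun t c u => forall s (w : forest Q s t),
          mR _ _ (comp _ _ u _ w) = comp' _ _ (mP _ _ u) _ (fmap mQ w)) us ->
  forall r (w : forest Q r s),
    fmap mR (fcomp comp us w) = fcomp comp' (fmap mP us) (fmap mQ w).
Proof.
elim: us => {s t} [|a c b t u us IH] k r w; first by elim/fnil_ind: r / w.
case: k => k /IH {}IH; elim/fcat_ind: r / w => r1 r2 w1 w2; rewrite fcomp_cons.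
apply: totf_inj; rewrite totf_fmap_cons k IH.
transitivity (totf (fcomp comp' (fcons (mP _ _ u) (fmap mP us))
                (fcat (fmap mQ w1) (fmap mQ w2)))).
  by rewrite fcomp_cons.
by apply: totf_fcomp; rewrite ?totf_fmap_cat ?totf_cast.
Qed.

Lemma totf_fmap_fmap (C D E : Type) (P : seq C -> C -> Type) (Q : seq D -> D -> Type)
    (R : seq E -> E -> Type) (h : C -> D) (k : D -> E)
    (m : forall s c, P s c -> Q (map h s) (h c))
    (n : forall s c, Q s c -> R (map k s) (k c))
    (nm : forall s c, P s c -> R (map (k \o h) s) (k (h c))) s t (x : forest P s t) :
  (forall s c (x : P s c), tot (nm s c x) = tot (n _ _ (m _ _ x))) ->
  totf (fmap nm x) = totf (fmap n (fmap m x)).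
Proof.
move=> e; elim: x => {s t} [|a c b t u us IH] //.
rewrite totf_fmap_cons.
transitivity (totf (fmap n (fcons (m _ _ u) (fmap m us)))).
  by rewrite totf_fmap_cons; apply: totf_cons.
by apply: totf_fmap; rewrite totf_fmap_cons.
Qed.

Lemma totf_fmap_id (C : Type) (P : seq C -> C -> Type)
    (m : forall s c, P s c -> P (map id s) c) s t (x : forest P s t) :
  (forall s c (x : P s c), tot (m s c x) = tot x) -> totf (fmap m x) = totf x.
Proof.
move=> e; elim: x => //= {s t} a c b t u us IH.
by rewrite totf_cast; apply: totf_cons.
Qed.

Lemma tot_op_comp (P : operad) t c (p : @op P t c) s (q : forest (@op P) s t)
    t' c' (p' : @op P t' c') s' (q' : forest (@op P) s' t') :
  tot p = tot p' -> totf q = totf q' -> tot (op_comp p q) = tot (op_comp p' q').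
Proof.
move=> /totP[et [ec ->]]; case: _ / et q'; case: _ / ec => q' /totfP[es [et ->]].
by case: _ / es; rewrite (Prop_irrelevance et erefl).
Qed.

Lemma operad_map_eq (P Q : operad) (f g : operad_map P Q) :
  cmap f =1 cmap g ->
  (forall s c (x : @op P s c), tot (omap f x) = tot (omap g x)) -> f = g.
Proof.
move=> /funext; case: f g => [f mf jf cf] [g mg jg cg] /= e.
move: mg jg cg; rewrite -{}e => mg jg cg /= em.
have {em}em : mf = mg.
  apply: functional_extensionality_dep => s.
  apply: functional_extensionality_dep => c.
  apply: funext => x; exact: (tot_inj (em s c x)).
move: jf cf jg cg; rewrite {}em => *; congr OperadMap; exact: Prop_irrelevance.
Qed.

Definition operad_map_id (P : operad) : operad_map P P.
Proof.
refine (@OperadMap P P id (fun s c x => castop (esym (map_id s)) x) _ _).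
- by move=> c; apply: tot_inj; rewrite tot_castop.
- move=> t c p s q; apply: tot_inj; rewrite tot_castop.
  apply: tot_op_comp; first by rewrite tot_castop.
  by rewrite totf_fmap_id // => *; rewrite tot_castop.
Defined.

Definition operad_map_comp (P Q R : operad) (g : operad_map Q R) (f : operad_map P Q) :
  operad_map P R.
Proof.
refine (@OperadMap P R (fun c => g (f c))
  (fun s c x => castop (esym (map_comp g f s)) (omap g (omap f x))) _ _).
- by move=> c; apply: tot_inj; rewrite tot_castop !omap_id.
- move=> t c p s q; apply: tot_inj; rewrite tot_castop !omap_comp.
  apply: tot_op_comp; first by rewrite tot_castop.
  by apply/esym/totf_fmap_fmap => *; rewrite tot_castop.
Defined.

Lemma tot_omap_comp (P Q R : operad) (g : operad_map Q R) (f : operad_map P Q) s c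
    (x : @op P s c) :
  tot (omap (operad_map_comp g f) x) = tot (omap g (omap f x)).
Proof. exact: tot_castop. Qed.

Definition Op_ns : category.
Proof.
refine (@Category operad operad_map operad_map_id operad_map_comp _ _ _).
- move=> P Q f; apply: operad_map_eq => // s c x.
  by rewrite tot_omap_comp /= tot_castop.
- move=> P Q f; apply: operad_map_eq => // s c x.
  rewrite tot_omap_comp; apply: totm; exact: tot_castop.
- move=> P Q R S h g f; apply: operad_map_eq => // s c x.
  rewrite !tot_omap_comp.
  transitivity (tot (omap h (omap g (omap f x)))).
    by apply: totm; rewrite tot_omap_comp.
  by [].
Defined.

Section Mirror.
Variables (C : Type).
Implicit Types P : seq C -> C -> Type.

(* [M(P)(c_1, ..., c_m; c) = P(c_m, ..., c_1; c)]. *)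
Definition mirror_op P : seq C -> C -> Type := fun s c => P (rev s) c.

Fixpoint frev P s t (f : forest (mirror_op P) s t) : forest P (rev s) (rev t) :=
  match f in forest _ s t return forest P (rev s) (rev t) with
  | fnil => fnil
  | fcons a c b t u us =>
      castf (esym (rev_cat a b)) (esym (rev_cat [:: c] t))
        (fcat (frev us) (fone (u : P (rev a) c)))
  end.

Lemma totf_frev P s t s' t' (x : forest (mirror_op P) s t) (y : forest (mirror_op P) s' t') :
  totf x = totf y -> totf (frev x) = totf (frev y).
Proof. by move=> /totfP[es [et ->]]; case: _ / es; case: _ / et. Qed.

Lemma totf_frev_cons P a c b t (u : mirror_op P a c) (us : forest (mirror_op P) b t) :
  totf (frev (fcons u us)) = totf (fcat (frev us) (fone (u : P (rev a) c))).
Proof. exact: totf_cast. Qed.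

Lemma totf_frev_cat P a b r1 r2 (x : forest (mirror_op P) r1 a)
    (y : forest (mirror_op P) r2 b) :
  totf (frev (fcat x y)) = totf (fcat (frev y) (frev x)).
Proof.
elim: x => {r1 a} [|r1 c b1 a u us IH]; first by rewrite totf_cat0.
transitivity (totf (frev (fcons u (fcat us y)))).
  by apply: totf_frev; rewrite totf_cast.
rewrite totf_frev_cons.
transitivity (totf (fcat (fcat (frev y) (frev us)) (fone (u : P (rev r1) c)))).
  exact: totf_cat.
by rewrite -totf_catA; apply: totf_cat => //; rewrite totf_frev_cons.
Qed.

Lemma totf_frev_one P s c (x : mirror_op P s c) :
  totf (frev (fone x)) = totf (fone (x : P (rev s) c)).
Proof.
transitivity (totf (frev (fcons x fnil))); first by apply: totf_frev; rewrite totf_cast.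
by rewrite totf_frev_cons.
Qed.

Lemma tot_mirror P s c s' c' (x : mirror_op P s c) (y : mirror_op P s' c') :
  tot (x : P (rev s) c) = tot (y : P (rev s') c') <-> tot x = tot y.
Proof.
split; last by move=> /totP[es [et ->]]; case: _ / es; case: _ / et.
move=> /totP[es [et]]; have e : s = s' by rewrite -(revK s) es revK.
move: y; case: _ / et; case: _ / e es => es y ->.
by rewrite (Prop_irrelevance es erefl).
Qed.

Lemma frev_fcomp P Q R
    (comp : forall t c, P t c -> forall s, forest Q s t -> R s c)
    s t (us : forest (mirror_op P) s t) r (w : forest (mirror_op Q) r s) :
  totf (frev (fcomp (R := mirror_op R)
     (fun t c (p : mirror_op P t c) s (q : forest (mirror_op Q) s t) =>
       comp (rev t) c p (rev s) (frev q)) us w)) =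
  totf (fcomp comp (frev us) (frev w)).
Proof.
elim: us r w => {s t} [|a c b t u us IH] r w; first by elim/fnil_ind: r / w.
elim/fcat_ind: r / w => r1 r2 w1 w2; rewrite fcomp_cons totf_frev_cons.
transitivity (totf (fcat (fcomp comp (frev us) (frev w2))
   (fcomp comp (fone (u : P (rev a) c)) (frev w1)))).
  by apply: totf_cat => //; rewrite totf_fcomp_one.
rewrite -totf_fcomp_cat; apply: totf_fcomp; first by rewrite totf_frev_cons.
by rewrite totf_frev_cat.
Qed.
End Mirror.

Lemma totf_frev_ids (C : Type) (P : seq C -> C -> Type) (u : forall c, P [:: c] c) s :
  totf (frev (fids (P := mirror_op P) u s)) = totf (fids u (rev s)).
Proof.
elim: s => [|c s IH] //.
have h a b : totf (fids u (a ++ b)) = totf (fcat (fids u a) (fids u b)).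
  elim: a => //= c0 a IHa; rewrite totf_cast.
  exact: (@totf_cons _ _ [:: c0] [:: c0]).
transitivity (totf (fcat (frev (fids (P := mirror_op P) u s)) (fone (u c)))).
  exact: (@totf_frev_cons _ P [:: c] c s s).
rewrite rev_cons -cats1 h; apply: totf_cat => //.
by rewrite totf_cast.
Qed.

Definition mirror_operad (P : operad) : operad.
Proof.
refine (@Operad (colour P) (mirror_op (@op P)) (fun c => op_id c)
  (fun t c (p : @op P (rev t) c) s q => op_comp p (frev q)) _ _ _).
- move=> s c p; apply: tot_inj; apply/tot_mirror.
  transitivity (tot (op_comp (op_id c) (fone (p : op (rev s) c)))).
    by apply: tot_op_comp => //; rewrite totf_frev_one.
  by rewrite op_idl.
- move=> s c p; apply: tot_inj; apply/tot_mirror.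
  transitivity (tot (op_comp (p : op (rev s) c) (fids op_id (rev s)))).
    by apply: tot_op_comp => //; rewrite totf_frev_ids.
  by rewrite op_idr.
- move=> t c p s q r w; apply: tot_inj; apply/tot_mirror.
  rewrite op_assoc; apply: tot_op_comp => //.
  exact/esym/frev_fcomp.
Defined.

Lemma frev_fmap (C D : Type) (h : C -> D) (P : seq C -> C -> Type) (Q : seq D -> D -> Type)
    (m : forall s c, P s c -> Q (map h s) (h c))
    (m' : forall s c, mirror_op P s c -> mirror_op Q (map h s) (h c))
    s t (us : forest (mirror_op P) s t) :
  (forall s c (x : mirror_op P s c),
     tot (m' s c x : Q (rev (map h s)) (h c)) = tot (m _ _ (x : P (rev s) c))) ->
  totf (frev (fmap m' us)) = totf (fmap m (frev us)).
Proof.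
move=> e; elim: us => {s t} [|a c b t u us IH] //.
transitivity (totf (frev (fcons (m' _ _ u) (fmap m' us)))).
  by apply: totf_frev; rewrite totf_fmap_cons.
rewrite totf_frev_cons.
transitivity (totf (fmap m (fcat (frev us) (fone (u : P (rev a) c))))).
  rewrite totf_fmap_cat; apply: totf_cat => //.
  by rewrite totf_fmap_one; apply: totf_one.
by apply: totf_fmap; rewrite totf_frev_cons.
Qed.

Definition mirror_map (P Q : operad) (f : operad_map P Q) :
  operad_map (mirror_operad P) (mirror_operad Q).
Proof.
refine (@OperadMap (mirror_operad P) (mirror_operad Q) (cmap f)
  (fun s c (x : @op P (rev s) c) => castop (P := @op Q) (map_rev f s) (omap f x)) _ _).
- move=> c; apply: tot_inj; apply/tot_mirror; rewrite tot_castop.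
  by apply: congr1; exact: omap_id.
- move=> t c p s q; apply: tot_inj; apply/tot_mirror; rewrite tot_castop.
  transitivity (tot (op_comp (omap f (p : @op P (rev t) c)) (@fmap _ _ (@op P) (@op Q) f (@omap P Q f) _ _ (@frev _ (@op P) _ _ q)))).
    by apply: congr1; apply: omap_comp.
  rewrite /=; apply: (@tot_op_comp Q); first by rewrite tot_castop.
  by apply/esym/frev_fmap => *; rewrite tot_castop.
Defined.

Lemma tot_mirror_map (P Q : operad) (f : operad_map P Q) s c (x : @op P (rev s) c) :
  tot (omap (mirror_map f) (x : @op (mirror_operad P) s c) :
    @op Q (rev (map f s)) (f c)) = tot (omap f x).
Proof. exact: tot_castop. Qed.

Definition mirror_functor : functor Op_ns Op_ns.
Proof.
refine (@Functor Op_ns Op_ns mirror_operad mirror_map _ _).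
- move=> P; apply: operad_map_eq => // s c x; apply/tot_mirror.
  by rewrite /= !tot_castop; apply/tot_mirror; rewrite tot_castop.
- move=> P Q R g f; apply: operad_map_eq => // s c x; apply/tot_mirror.
  transitivity (tot (omap g (omap f (x : @op P (rev s) c)))).
    by rewrite /= !tot_castop.
  transitivity (tot (omap g (omap (mirror_map f) x : @op Q (rev (map f s)) (f c)))).
    by apply: totm; rewrite tot_mirror_map.
  transitivity (tot (omap (mirror_map g) (omap (mirror_map f) x) :
    @op R (rev (map g (map f s))) (g (f c)))).
    by rewrite /= !tot_castop.
  by apply/tot_mirror; rewrite tot_omap_comp.
Defined.

Section Free.
Variables (C : Type) (G : seq C -> C -> Type).

(* Operations of the free operad with colours [C] and generators [G]. *)
Inductive fterm : seq C -> C -> Type :=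
| fvar c : fterm [:: c] c
| fnode s t c : G t c -> forest fterm s t -> fterm s c.

Definition fterm_elim (K : forall s c, fterm s c -> Prop)
    (kvar : forall c, K _ _ (fvar c))
    (knode : forall s t c (g : G t c) (us : forest fterm s t),
      fAll K us -> K _ _ (fnode g us)) : forall s c x, K s c x :=
  fix F s c (x : fterm s c) : K s c x :=
    match x with
    | fvar c => kvar c
    | fnode s t c g us => knode s t c g us
        ((fix FF s t (us : forest fterm s t) : fAll K us :=
          match us with
          | fnil => I
          | fcons a c b t u us' => conj (F a c u) (FF b t us')
          end) s t us)
    end.

Definition fhead r c (f : forest fterm r [:: c]) : fterm r c :=
  match funcons f in uncons_forest _ _ _ r return fterm r c with
  | UnconsForest a b x f' =>
      match f' in forest _ b t return (if t is [::] then fterm (a ++ b) c else unit) with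
      | fnil => castop (esym (cats0 a)) x
      | fcons _ _ _ _ _ _ => tt
      end
  end.

Fixpoint free_comp s c (p : fterm s c) : forall r, forest fterm r s -> fterm r c :=
  match p in fterm s c return forall r, forest fterm r s -> fterm r c with
  | fvar c => fun r w => fhead w
  | fnode s t c g us => fun r w => fnode g (fcomp free_comp us w)
  end.

Lemma tot_fhead r c r' c' (f : forest fterm r [:: c]) (f' : forest fterm r' [:: c']) :
  totf f = totf f' -> tot (fhead f) = tot (fhead f').
Proof.
move=> /totfP[es [et ->]]; case: _ / es; have ec : c = c' by case: et.
by case: _ / ec et {f'} => et; rewrite (Prop_irrelevance et erefl).
Qed.

Lemma fhead_one s c (x : fterm s c) : fhead (fone x) = x.
Proof.
apply: tot_inj; transitivity (tot (fhead (fcons x fnil))).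
  by apply: tot_fhead; rewrite totf_cast.
by rewrite /fhead /= tot_castop.
Qed.

Lemma free_idr s c (p : fterm s c) : free_comp p (fids fvar s) = p.
Proof.
elim/fterm_elim: s c / p => [c|s t c g us IH] /=.
  by rewrite -[RHS]fhead_one; apply: tot_inj; apply: tot_fhead; rewrite totf_cast.
congr fnode; elim: us IH {g} => {s t} [|a d b t u us IH] //.
case=> hu /IH{}IH; apply: totf_inj.
have h a' b' : totf (fids fvar (a' ++ b')) = totf (fcat (fids fvar a') (fids fvar b')).
  elim: a' => //= c0 a' IHa; rewrite totf_cast.
  exact: (@totf_cons _ _ [:: c0] [:: c0]).
transitivity (totf (fcomp free_comp (fcons u us) (fcat (fids fvar a) (fids fvar b)))).
  exact: totf_fcomp.
by rewrite fcomp_cons hu IH.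
Qed.

Lemma free_assoc t c (p : fterm t c) s (q : forest fterm s t) r (w : forest fterm r s) :
  free_comp (free_comp p q) w = free_comp p (fcomp free_comp q w).
Proof.
elim/fterm_elim: t c / p s q r w => [c|s t c g us IH] s' q r w /=; last first.
  by congr fnode; apply: fcomp_assoc.
elim/fone_ind: s' / q w => s x w; rewrite fhead_one -[LHS]fhead_one.
by apply: tot_inj; apply: tot_fhead; rewrite totf_fcomp_one.
Qed.

Definition free_operad : operad :=
  @Operad C fterm fvar free_comp (fun s c p => fhead_one p) free_idr free_assoc.

Definition free_gen s c (g : G s c) : @op free_operad s c := fnode g (fids fvar s).

Section Universal.
Variables (Q : operad) (h : C -> colour Q).
Variable m : forall s c, G s c -> @op Q (map h s) (h c).

Fixpoint free_ext s c (x : fterm s c) : @op Q (map h s) (h c) :=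
  match x in fterm s c return @op Q (map h s) (h c) with
  | fvar c => op_id (h c)
  | fnode s t c g us => op_comp (m g) (fmap free_ext us)
  end.

Lemma free_ext_comp t c (p : fterm t c) s (q : forest fterm s t) :
  free_ext (free_comp p q) = op_comp (free_ext p) (fmap free_ext q).
Proof.
elim/fterm_elim: t c / p s q => [c|r t c g us IH] s q /=.
  elim/fone_ind: s / q => s x; rewrite fhead_one -[LHS]op_idl.
  by apply: tot_inj; apply: tot_op_comp => //; rewrite totf_fmap_one.
rewrite op_assoc; congr op_comp.
exact: (@totf_fmap_comp _ _ h fterm fterm fterm (@op Q) (@op Q) (@op Q)).
Qed.

Definition free_ext_map : operad_map free_operad Q :=
  @OperadMap free_operad Q h free_ext (fun c => erefl) free_ext_comp.

Lemma fmap_ids s : totf (fmap free_ext (fids fvar s)) = totf (fids op_id (map h s)).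
Proof.
elim: s => //= c s IH; rewrite totf_cast.
exact: (@totf_cons _ _ [:: h c] [:: h c]).
Qed.

Lemma free_ext_gen s c (g : G s c) : free_ext (free_gen g) = m g.
Proof.
apply: tot_inj; rewrite -[RHS](congr1 _ (op_idr (m g))) /=.
by apply: tot_op_comp => //; rewrite fmap_ids.
Qed.
End Universal.

(* The universal property of the free operad: [free_ext_map], [free_ext_gen]
   and the following uniqueness statement. *)
Lemma free_map_eq (Q : operad) (f g : operad_map free_operad Q) :
  cmap f =1 cmap g ->
  (forall s c (x : G s c), tot (omap f (free_gen x)) = tot (omap g (free_gen x))) ->
  f = g.
Proof.
move=> e eg; apply: operad_map_eq => // s c x.
elim/fterm_elim: s c / x => [c|s t c u us IH].
  transitivity (tot (@op_id Q (f c))); first by apply: congr1; apply: (omap_id f).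
  rewrite e; apply/esym; apply: congr1; exact: (omap_id g).
have nodeE : fnode u us = op_comp (free_gen u) (us : forest (@op free_operad) s t).
  rewrite /=; congr fnode; elim: us {IH} => // a d b t' v vs IH.
  transitivity (fcomp free_comp (@fcons _ _ [:: d] d t' t' (fvar d) (fids fvar t'))
     (fcat (fone v) vs)).
    rewrite fcomp_cons /= fhead_one; congr fcons; exact: IH.
  apply: totf_inj; apply: totf_fcomp => //; exact/esym/fcons_one.
rewrite nodeE !omap_comp; apply: tot_op_comp; first exact: eg.
elim: us IH {u nodeE} => {s t} [|a d b t' v vs IH] //.
case=> hv /IH{}IH; rewrite !totf_fmap_cons; exact: totf_cons.
Qed.

End Free.

Lemma free_isom (C D : Type) (G : seq C -> C -> Type) (H : seq D -> D -> Type)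
    (h : C -> D) (k : D -> C)
    (m : forall s c, G s c -> H (map h s) (h c))
    (n : forall s c, H s c -> G (map k s) (k c)) :
  cancel h k -> cancel k h ->
  (forall s c (x : G s c), tot (n _ _ (m _ _ x)) = tot x) ->
  (forall s c (x : H s c), tot (m _ _ (n _ _ x)) = tot x) ->
  exists f : @hom Op_ns (free_operad G) (free_operad H), is_isom f.
Proof.
move=> hk kh nm mn.
have tot_gen (E : Type) (K : seq E -> E -> Type) s c s' c' (x : K s c) (y : K s' c') :
    tot x = tot y -> tot (free_gen x) = tot (free_gen y).
  by move=> /totP[es [ec ->]]; case: _ / es; case: _ / ec.
pose f := free_ext_map (Q := free_operad H) (h := h) (fun s c x => free_gen (m s c x)).
pose g := free_ext_map (Q := free_operad G) (h := k) (fun s c x => free_gen (n s c x)).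
have fE s c (x : G s c) : omap f (free_gen x) = free_gen (m s c x).
  exact: free_ext_gen.
have gE s c (x : H s c) : omap g (free_gen x) = free_gen (n s c x).
  exact: free_ext_gen.
exists f, g; split.
- apply: free_map_eq => // s c x; rewrite tot_omap_comp fE gE /= tot_castop.
  exact: tot_gen.
- apply: free_map_eq => // s c x; rewrite tot_omap_comp gE fE /= tot_castop.
  exact: tot_gen.
Qed.

(* The components of the canonical isomorphism [M \o M ~ id]. *)
Definition mirror2_map (P : operad) : operad_map (mirror_operad (mirror_operad P)) P.
Proof.
pose m s c (x : @op P (rev (rev s)) c) : @op P (map id s) c :=
  castop (P := @op P) (etrans (revK s) (esym (map_id s))) x.
refine (@OperadMap (mirror_operad (mirror_operad P)) P id m _ _).
- by move=> c; apply: tot_inj; rewrite tot_castop.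
- move=> t c p s q; apply: tot_inj; rewrite tot_castop /=.
  apply: (@tot_op_comp P); first by rewrite tot_castop.
  elim: q => {s t p} [|a d b t u us IH] //.
  rewrite totf_fmap_cons -[fmap _ _]/(fmap m us).
  transitivity (totf (frev (fcat (frev us) (fone (u : mirror_op (@op P) (rev a) d))))).
    by apply: totf_frev; rewrite totf_frev_cons.
  rewrite totf_frev_cat fcons_one; apply: totf_cat => //.
  by rewrite totf_frev_one; apply: totf_one; rewrite tot_castop.
Defined.

Lemma tot_mirror2_map (P : operad) s c (x : @op P (rev (rev s)) c) :
  tot (omap (mirror2_map P) (x : @op (mirror_operad (mirror_operad P)) s c)) = tot x.
Proof. exact: tot_castop. Qed.

Lemma free_mirror_isom (C : Type) (G H : seq C -> C -> Type)
    (m : forall s c, H s c -> G (rev s) c) (n : forall s c, G s c -> H (rev s) c) :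
  (forall s c (x : H s c), tot (n _ _ (m _ _ x)) = tot x) ->
  (forall s c (x : G s c), tot (m _ _ (n _ _ x)) = tot x) ->
  exists f : @hom Op_ns (mirror_operad (free_operad G)) (free_operad H), is_isom f.
Proof.
move=> nm mn.
have tot_gen (K : seq C -> C -> Type) s c s' c' (x : K s c) (y : K s' c') :
    tot x = tot y -> tot (free_gen x) = tot (free_gen y).
  by move=> /totP[es [ec ->]]; case: _ / es; case: _ / ec.
pose e (K L : seq C -> C -> Type) (a : forall s c, K s c -> L (rev s) c) :
    operad_map (free_operad K) (mirror_operad (free_operad L)) :=
  free_ext_map (Q := mirror_operad (free_operad L)) (h := id)
    (fun s c x => castop (P := @op (mirror_operad (free_operad L))) (esym (map_id s))
      (free_gen (a s c x))).
have eE K L a s c (x : K s c) :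
    tot (omap (e K L a) (free_gen x) : @op (free_operad L) (rev (map id s)) c)
    = tot (free_gen (a s c x)).
  transitivity (tot (castop (P := @op (mirror_operad (free_operad L))) (esym (map_id s))
      (free_gen (a s c x)) : @op (free_operad L) (rev (map id s)) c)).
    apply: congr1; exact: (@free_ext_gen _ _ (mirror_operad (free_operad L)) id).
  by apply/tot_mirror; rewrite tot_castop.
have totm' (P Q : operad) (f : operad_map P (mirror_operad Q)) s c s' c'
    (x : @op P s c) (y : @op P s' c') : tot x = tot y ->
    tot (omap f x : @op Q (rev (map f s)) (f c)) =
    tot (omap f y : @op Q (rev (map f s')) (f c')).
  by move=> /totP[es [ec ->]]; case: _ / es; case: _ / ec.
have tot2 (P : operad) s c s' c' (x : @op (mirror_operad (mirror_operad P)) s c)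
    (y : @op (mirror_operad (mirror_operad P)) s' c') : tot x = tot y ->
    tot (x : @op P (rev (rev s)) c) = tot (y : @op P (rev (rev s')) c').
  by move=> /totP[es [ec ->]]; case: _ / es; case: _ / ec.
have tot1 (P : operad) s c s' c' (x : @op (mirror_operad P) s c)
    (y : @op (mirror_operad P) s' c') : tot x = tot y ->
    tot (x : @op P (rev s) c) = tot (y : @op P (rev s') c').
  by move=> /totP[es [ec ->]]; case: _ / es; case: _ / ec.
pose phi := e H G m; pose chi := e G H n.
pose psi : operad_map (mirror_operad (free_operad G)) (free_operad H) :=
  operad_map_comp (mirror2_map _) (mirror_map chi).
have psiE s c (x : @op (free_operad G) (rev s) c) :
    tot (omap psi (x : @op (mirror_operad (free_operad G)) s c)) =
    tot (omap chi x : @op (free_operad H) _ _).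
  rewrite tot_omap_comp.
  transitivity (tot (omap (mirror_map chi) (x : @op (mirror_operad (free_operad G)) s c) :
      @op (free_operad H) (rev (rev (map chi s))) (chi c))).
    exact: tot_mirror2_map.
  apply: (proj2 (@tot_mirror _ (@op (free_operad H)) _ _ _ _
     (omap (mirror_map chi) (x : @op (mirror_operad (free_operad G)) s c) :
       mirror_op _ (rev (map chi s)) (chi c)) (omap chi x))).
  exact: (@tot_mirror_map _ _ chi).
have chiphi s c (x : @op (free_operad G) s c) :
    tot (omap phi (omap chi x : @op (free_operad H) (rev (map id s)) c) :
       @op (free_operad G) (rev (map id (rev (map id s)))) c) = tot x.
  pose w := operad_map_comp (mirror2_map _) (operad_map_comp (mirror_map phi) chi).
  have wE s' c' (y : @op (free_operad G) s' c') : tot (omap w y) =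
      tot (omap phi (omap chi y : @op (free_operad H) (rev (map id s')) c') :
       @op (free_operad G) (rev (map id (rev (map id s')))) c').
    rewrite tot_omap_comp.
    transitivity (tot (omap (operad_map_comp (mirror_map phi) chi) y :
       @op (free_operad G) (rev (rev (map id s'))) c')).
      exact: tot_mirror2_map.
    transitivity (tot (omap (mirror_map phi) (omap chi y) :
       @op (free_operad G) (rev (rev (map id (map id s')))) c')).
      exact: (@tot2 (free_operad G) _ _ _ _ (omap (operad_map_comp (mirror_map phi) chi) y)
        (omap (mirror_map phi) (omap chi y)) (tot_omap_comp _ _ _)).
    apply: (proj2 (tot_mirror _ _)).
    exact: (@tot_mirror_map _ _ phi).
  have w1 : w = operad_map_id (free_operad G).
    apply: free_map_eq => // s' c' y; rewrite wE /= tot_castop.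
    transitivity (tot (omap phi (free_gen (n _ _ y)) : @op (free_operad G) _ _)).
      apply: (@totm' (free_operad H) (free_operad G) phi (rev (map id s')) c' (rev s') c').
      exact: eE.
    by rewrite eE; apply: tot_gen.
  by rewrite -wE w1 /= tot_castop.
exists psi, phi; split; last first.
- apply: free_map_eq => // s c x; rewrite tot_omap_comp.
  transitivity (tot (omap chi (omap phi (free_gen x) : @op (free_operad G) (rev (map id s)) c)
     : @op (free_operad H) _ _)); first exact: psiE.
  transitivity (tot (omap chi (free_gen (m _ _ x)) : @op (free_operad H) _ _)).
    apply: (@totm' (free_operad G) (free_operad H) chi (rev (map id s)) c (rev s) c).
    exact: eE.
  by rewrite eE /= tot_castop; apply: tot_gen.
- apply: operad_map_eq => // s c x; rewrite tot_omap_comp.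
  apply: (proj1 (tot_mirror _ _)).
  transitivity (tot (omap phi (omap chi (x : @op (free_operad G) (rev s) c) :
     @op (free_operad H) (rev (map id (rev s))) c) :
       @op (free_operad G) (rev (map id (rev (map id (rev s))))) c)).
    apply: (@totm' (free_operad H) (free_operad G) phi _ c _ c); exact: psiE.
  rewrite chiphi; apply: (proj2 (tot_mirror _ _)).
  by rewrite /= tot_castop.
Qed.

(* Combinatorial trees, as simple graphs: [branches] is the set of edges, and
   the edge between [x] and [y] is the pair [[set x; y]]. *)
Record combinatorial_tree := CombinatorialTree {
  node : finType;
  branches : {set {set node}};
  branches_card : forall A, A \in branches -> #|A| = 2;
  node_nonempty : 0 < #|node|;
  adj : rel node := fun x y => [set x; y] \in branches;
  tree_connected : forall x y, connect adj x y;
  tree_acyclic : forall c, uniq c -> cycle adj c -> size c <= 2 }.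

Definition outer (T : combinatorial_tree) (x : node T) : bool :=
  #|[set A in branches T | x \in A]| == 1.

Record tree := Tree {
  shape :> combinatorial_tree;
  output : node shape;
  inputs : {set node shape};
  output_outer : outer output;
  inputs_outer : forall x, x \in inputs -> outer x;
  output_notin_inputs : output \notin inputs }.

Definition vertex (T : tree) := {v : node T | (v \notin inputs T) && (v != output T)}.
Definition edge (T : tree) := {e : {set node T} | e \in branches T}.

(* The edge between [x] and [y] is oriented from [x] to [y]: a simple path from
   [x] to the output node starts with it. *)
Definition oriented (T : tree) (x y : node T) : Prop :=
  exists p : seq (node T),
    [/\ path (@adj T) x (y :: p), uniq (x :: y :: p) & last y p = output T].

Definition is_input_edge (T : tree) (v : vertex T) (e : edge T) : Prop :=
  exists w, oriented w (sval v) /\ sval e = [set w; sval v].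

Definition is_output_edge (T : tree) (v : vertex T) (e : edge T) : Prop :=
  exists w, oriented (sval v) w /\ sval e = [set sval v; w].

(* The linear order on the input edges of [v] is given by listing them in
   increasing order. *)
Record planar_tree := PlanarTree {
  unplanar :> tree;
  input_edges : vertex unplanar -> seq (edge unplanar);
  input_edges_uniq : forall v, uniq (input_edges v);
  input_edgesP : forall v e, e \in input_edges v <-> is_input_edge v e }.

Definition planar_tree_iso (S T : planar_tree) (f : node S -> node T) : Prop :=
  [/\ bijective f,
      forall A : {set node S}, (f @: A \in branches T) = (A \in branches S),
      f (output S) = output T,
      f @: inputs S = inputs T &
      forall (v : vertex S) (w : vertex T), f (sval v) = sval w ->
        [seq f @: sval e | e : edge S <- input_edges v] = [seq sval e | e : edge T <- input_edges w]].

Definition isomorphic (S T : planar_tree) : Prop :=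
  exists f : node S -> node T, planar_tree_iso f.

(* The free operad is generated by one operation [e_1, ..., e_m -> e] for each
   vertex with input edges [e_1 < ... < e_m] and output edge [e]. *)
Definition vertex_gen (T : planar_tree) (s : seq (edge T)) (e : edge T) : Type :=
  {v : vertex T | input_edges v = s /\ is_output_edge v e}.

Lemma vertex_gen_eq (T : planar_tree) s e s' e' (x : @vertex_gen T s e)
    (y : @vertex_gen T s' e') : e = e' -> sval x = sval y -> tot x = tot y.
Proof.
move=> ee; case: x y => v [h o] [w [h' o']] /= vw.
by subst; rewrite (Prop_irrelevance o o').
Qed.

Definition tree_operad (T : planar_tree) : operad := free_operad (@vertex_gen T).

Lemma mirror_tree_uniq (T : planar_tree) (v : vertex T) : uniq (rev (input_edges v)).
Proof. by rewrite rev_uniq input_edges_uniq. Qed.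

Lemma mirror_treeP (T : planar_tree) (v : vertex T) (e : edge T) :
  e \in rev (input_edges v) <-> is_input_edge v e.
Proof. by rewrite mem_rev; apply: input_edgesP. Qed.

Definition mirror_tree (T : planar_tree) : planar_tree :=
  @PlanarTree T (fun v => rev (input_edges v)) (@mirror_tree_uniq T) (@mirror_treeP T).

Lemma tree_operad_mirror (T : planar_tree) :
  exists f : @hom Op_ns (mirror_operad (tree_operad T)) (tree_operad (mirror_tree T)),
    is_isom f.
Proof.
have ex s e (x : @vertex_gen T s e) : rev (input_edges (sval x)) = rev s /\ is_output_edge (sval x) e.
  by case: x => v /= [<-].
have ey s e (x : @vertex_gen (mirror_tree T) s e) :
    input_edges (sval x : vertex T) = rev s /\ is_output_edge (sval x) e.
  by case: x => v /= [<-]; rewrite revK.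
apply: (@free_mirror_isom _ (@vertex_gen T) (@vertex_gen (mirror_tree T))
  (fun s e x => exist _ (sval x) (ey s e x)) (fun s e x => exist _ (sval x) (ex s e x))).
- by move=> s e x; apply: (@vertex_gen_eq (mirror_tree T)).
- by move=> s e x; apply: (@vertex_gen_eq T).
Qed.

Section Iso.

Lemma planar_tree_iso_id (T : planar_tree) : planar_tree_iso (@id (node T)).
Proof.
split=> //; first by exists id.
- by move=> A; rewrite imset_id.
- by rewrite imset_id.
- by move=> v w /val_inj ->; apply: eq_map => e; rewrite imset_id.
Qed.

Variables (S T : planar_tree) (f : node S -> node T).
Hypothesis fiso : planar_tree_iso f.

Lemma iso_edge (e : edge S) : f @: sval e \in branches T.
Proof. by case: fiso => _ -> _ _ _; case: e. Qed.

Lemma iso_vertex (v : vertex S) :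
  (f (sval v) \notin inputs T) && (f (sval v) != output T).
Proof.
case: fiso => /bij_inj fi _ eo el _; rewrite -eo -el.
by rewrite mem_imset // (inj_eq fi); case: v.
Qed.

Definition edge_map (e : edge S) : edge T :=
  exist (fun A => A \in branches T) (f @: sval e) (iso_edge e).
Definition vertex_map (v : vertex S) : vertex T :=
  exist (fun x => (x \notin inputs T) && (x != output T)) (f (sval v)) (iso_vertex v).

Lemma input_edges_map (v : vertex S) : input_edges (vertex_map v) = map edge_map (input_edges v).
Proof.
case: fiso => _ _ _ _ /(_ v (vertex_map v) erefl) e.
apply: (@inj_map _ _ (fun e : edge T => sval e)); first by move=> x y; apply: val_inj.
by rewrite -e -map_comp.
Qed.

Lemma output_edge_map (v : vertex S) (e : edge S) :
  is_output_edge v e -> is_output_edge (vertex_map v) (edge_map e).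
Proof.
case: fiso => /bij_inj fi fE fo _ _ [w [[p [pp up lp]] ee]]; exists (f w); split; last first.
  by rewrite /= ee imsetU !imset_set1.
exists (map f p); split.
- change (path (@adj T) (f (sval v)) (map f (w :: p))).
  move: pp; elim: (w :: p) (sval v) => //= x q IH y /andP[yx /IH ->]; rewrite andbT.
  by rewrite /adj in yx *; rewrite -fE imsetU !imset_set1 in yx.
- by rewrite -[_ :: _]/(map f (sval v :: w :: p)) map_inj_uniq.
- by rewrite last_map lp.
Qed.

End Iso.

Lemma planar_tree_iso_inv (S T : planar_tree) (f : node S -> node T)
    (g : node T -> node S) :
  cancel f g -> cancel g f -> planar_tree_iso f -> planar_tree_iso g.
Proof.
move=> fg gf fiso; have [fb fE fo fl fi] := fiso.
have fgs (A : {set node S}) : g @: (f @: A) = A.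
  by rewrite -imset_comp -[RHS]imset_id; apply: eq_imset.
have gfs (A : {set node T}) : f @: (g @: A) = A.
  by rewrite -imset_comp -[RHS]imset_id; apply: eq_imset.
split=> //; first by exists f.
- by move=> A; rewrite -fE gfs.
- by rewrite -fo fg.
- by rewrite -fl fgs.
- move=> w v e; have /fi h : f (sval v) = sval w by rewrite -e gf.
  rewrite -[RHS]map_id -[LHS]/(map ((fun A : {set node T} => g @: A) \o (fun e => sval e)) _).
  rewrite map_comp -h -map_comp -map_comp; apply: eq_map => x /=; exact: fgs.
Qed.

Lemma tree_operad_iso (S T : planar_tree) : isomorphic S T ->
  exists f : @hom Op_ns (tree_operad S) (tree_operad T), is_isom f.
Proof.
move=> [f fiso]; have [[g fg gf] _ _ _ _] := fiso.
have giso := planar_tree_iso_inv fg gf fiso.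
have ex (A B : planar_tree) (h : node A -> node B) (hi : planar_tree_iso h) s e
   (x : @vertex_gen A s e) : input_edges (vertex_map hi (sval x)) = map (edge_map hi) s /\
     is_output_edge (vertex_map hi (sval x)) (edge_map hi e).
  by case: x => v [iv o] /=; rewrite -{}iv; split; [apply: input_edges_map | apply: output_edge_map].
have fgs (A : {set node S}) : g @: (f @: A) = A.
  by rewrite -imset_comp -[RHS]imset_id; apply: eq_imset.
have gfs (A : {set node T}) : f @: (g @: A) = A.
  by rewrite -imset_comp -[RHS]imset_id; apply: eq_imset.
have efg : cancel (edge_map fiso) (edge_map giso).
  by move=> e; apply: val_inj => /=; apply: fgs.
have egf : cancel (edge_map giso) (edge_map fiso).
  by move=> e; apply: val_inj => /=; apply: gfs.
apply: (@free_isom _ _ (@vertex_gen S) (@vertex_gen T) (edge_map fiso) (edge_map giso)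
  (fun s e x => exist _ (vertex_map fiso (sval x)) (ex _ _ _ fiso s e x))
  (fun s e x => exist _ (vertex_map giso (sval x)) (ex _ _ _ giso s e x))) => //.
- by move=> s e x; apply: vertex_gen_eq => //; apply: val_inj => /=; apply: fg.
- by move=> s e x; apply: vertex_gen_eq => //; apply: val_inj => /=; apply: gf.
Qed.

(* Isomorphism classes of planar trees, each with a chosen representative. *)
Definition tree_class := {K : planar_tree -> Prop | exists T, K = isomorphic T}.

Definition class_of (T : planar_tree) : tree_class :=
  exist _ (isomorphic T) (ex_intro _ T erefl).

Definition repr_tree (K : tree_class) : planar_tree := sval (cid (svalP K)).

Lemma repr_class_of (T : planar_tree) : isomorphic T (repr_tree (class_of T)).
Proof.
rewrite /repr_tree; case: cid => U /= ->.
by exists id; apply: planar_tree_iso_id.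
Qed.

Definition Omega_ns : category :=
  @full_cat Op_ns tree_class (fun K => tree_operad (repr_tree K)).

Definition mirror_class (K : tree_class) : tree_class :=
  class_of (mirror_tree (repr_tree K)).

Lemma mirror_class_isom (K : tree_class) :
  exists f : @hom Op_ns (mirror_functor (tree_operad (repr_tree K)))
                        (tree_operad (repr_tree (mirror_class K))), is_isom f.
Proof.
have [f fi] := tree_operad_mirror (repr_tree K).
have [g gi] := tree_operad_iso (repr_class_of (mirror_tree (repr_tree K))).
exists (@mcomp Op_ns _ _ _ g f); exact: mcomp_isom.
Qed.

(* The choice is immaterial: planar trees have no nontrivial automorphisms, so
   there is only one such isomorphism. *)
Definition mirror_isom (K : tree_class) :
  @hom Op_ns (mirror_functor (tree_operad (repr_tree K)))
             (tree_operad (repr_tree (mirror_class K))) :=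
  sval (cid (mirror_class_isom K)).

Lemma mirror_isomP (K : tree_class) : is_isom (mirror_isom K).
Proof. exact: svalP. Qed.

(* The functor induced by [mirror_functor] on [Omega_ns]: it sends the class of
   [T] to the class of [mirror_tree T], and [f] to [u \o mirror_functor f \o v],
   where [u] and [v] are the identifications [mirror_isom] and their inverses. *)
Definition Omega_mirror : functor Omega_ns Omega_ns :=
  @induced_functor Op_ns tree_class (fun K => tree_operad (repr_tree K))
    mirror_functor mirror_class mirror_isom
    (fun K => sval (cid (mirror_isomP K)))
    (fun K => svalP (cid (mirror_isomP K))).

(* Main.v *)
Require Import Defs.
From mathcomp Require Import all_boot ssralg zmodp.
From mathcomp Require Import boolp.
Set Implicit Arguments. Unset Strict Implicit. Unset Printing Implicit Defensive.

(** The category of planar trees is thin enough to be handled through edges. The free operad of a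
tree has at most one operation with given inputs and output ([fterm_irr]), namely a subtree, and
once the output is given, even the set of inputs, without its order, determines the operation
([opr_inj]). Hence a map of trees is the same thing as a map of edges that sends vertices to
operations ([tree_map_eq], [tree_map_ex]). Vertices can be recovered from operations by a universal
property ([vtx_iso]), and a planar tree can be rebuilt from its edges and vertices
([isomorphic_of_edges]), so that isomorphic objects are equal ([Omega_skeletal]); as an automorphism
fixes the root and preserves the order of the children of each vertex, it is the identity
([Omega_rigid]). Consequently naturally isomorphic functors into this category are equal
([Omega_natiso_eq]).

Let [F] be an autoequivalence. The tree [eta] without vertices is characterized by having a map to
every tree and no endomorphism but the identity, so [F eta] is again a point, and [F] induces a
natural bijection [gamma F] from the edges of [K], which are the maps from [eta] to [K], to the
edges of [F K]. Corollas, that is trees with one vertex, are characterized among the trees with at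
least one vertex by a condition on the maps into them ([is_corolla_like], [corolla_like_Gen]), so
[F] permutes the edges of each corolla ([F_corolla]). Operations of [K] are maps from corollas to
[K]; what remains is to find the permutations. For the binary corolla, grafting two of them shows
that the root goes to the root ([F_corolla2_root]), so that the two inputs are either kept or
exchanged. Grafting an [n]-ary vertex onto a binary one produces an operation of arity [n.+1] whose
inputs are then ordered as in [K], or in the opposite way, because the order of the inputs is
determined by their set ([preservesS]). By induction [F] preserves all operations, or reverses all
of them ([F_direct_or_reversed]), and [F] is the identity or the mirror functor
([equivalence_id_or_mirror]). Applied to edges, the same reasoning shows that the mirror functor is
an involution ([mirror_involutive]).

A natural transformation between autoequivalences is determined by its component at [eta], where
there is no choice ([nattrans_unique]). A transformation between the identity and the mirror functor
would exchange the inputs of a binary vertex, which is impossible. So [Aut Omega_ns] is discrete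
with two objects, and all laws of the inverse functor reduce to equations between objects. *)

(** * Lists *)

Lemma flatten_id (A : Type) (s : seq A) : flatten [seq [:: x] | x <- s] = s.
Proof. by elim: s => //= x s ->. Qed.

Lemma filter_flatten_block (A B : eqType) (p : pred B) (f : A -> seq B) t x :
  uniq t -> x \in t -> (forall y b, y \in t -> b \in f y -> p b = (y == x)) ->
  filter p (flatten (map f t)) = f x.
Proof.
elim: t => //= y t IH /andP[yt ut]; rewrite inE filter_cat => xyt pP.
have {}IH : x \in t -> filter p (flatten (map f t)) = f x.
  by move=> xt; apply: IH => // z b zt; apply: pP; rewrite inE zt orbT.
have yP b : b \in f y -> p b = (y == x) by apply: pP; rewrite inE eqxx.
rewrite (eq_in_filter yP); case: (eqVneq y x) xyt => [yx _|/negPf yx].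
  rewrite filter_predT yx -[RHS]cats0; congr cat; apply/eqP.
  rewrite -[_ == _]negbK -has_filter; apply/hasPn => b /flatten_mapP[z zt bz].
  rewrite (pP z) ?inE ?zt ?orbT //; apply: contraNneq yt => zx; by rewrite yx -zx.
by rewrite filter_pred0 => /IH.
Qed.

Definition rev_if (T : Type) (b : bool) (s : seq T) := if b then rev s else s.

Lemma map_rev_if (T T' : Type) (f : T -> T') b s : map f (rev_if b s) = rev_if b (map f s).
Proof. by case: b; rewrite //= map_rev. Qed.

Lemma size_rev_if (T : Type) b (s : seq T) : size (rev_if b s) = size s.
Proof. by case: b; rewrite //= size_rev. Qed.

Lemma rev_if_inj (T : Type) b : injective (@rev_if T b).
Proof. by case: b => // s t; apply: (can_inj revK). Qed.

Lemma mem_rev_if (T : eqType) b (s : seq T) : rev_if b s =i s.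
Proof. by case: b => x; rewrite //= mem_rev. Qed.

Lemma perm_eq2 (T : eqType) (s : seq T) (x y : T) : perm_eq s [:: x; y] ->
  exists b, s = rev_if b [:: x; y].
Proof.
move=> sxy; move: (perm_size sxy); case: s sxy => [|u [|v []]] // uvxy _.
have := perm_mem uvxy u; rewrite mem_head !inE => /esym/orP[]/eqP ux.
  by exists false;
    move: uvxy; rewrite ux perm_cons => /perm_mem/(_ v); rewrite !inE eqxx => /esym/eqP->.
exists true; move: uvxy; rewrite ux (perm_sym _ [:: x; y]) (perm_catC [:: x] [:: y]) perm_cons.
by move=> /perm_mem/(_ x); rewrite !inE eqxx => /esym/eqP->.
Qed.

(** * Operations in a tree *)

Section Operations.
Variables (E : eqType) (G : seq E -> E -> Prop).

(** Existence of an operation from [s] to [c] in the free operad generated by the vertices [G]. The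
inputs of a vertex are pairwise distinct in a tree, so the operations plugged into them can be
indexed by the inputs themselves. *)
Inductive opr : seq E -> E -> Prop :=
| opr_id c : opr [:: c] c
| opr_vtx t c (f : E -> seq E) : G t c -> (forall e, e \in t -> opr (f e) e) ->
    opr (flatten (map f t)) c.

Definition below e c := exists2 s, opr s c & e \in s.

(** The properties of the edges and vertices of a planar tree on which everything below rests: [G s c]
says that [s] lists the input edges of the vertex with output edge [c]. The depth makes the
descendant relation [below] an order in which siblings are incomparable. *)
Record is_tree : Prop := IsTree {
  vtx_fun : forall s s' c, G s c -> G s' c -> s = s';
  vtx_uniq : forall s c, G s c -> uniq s;
  vtx_parent : forall s s' c c' e, G s c -> G s' c' -> e \in s -> e \in s' -> c = c';
  vtx_depth : exists d : E -> nat, forall s c e, G s c -> e \in s -> d e = (d c).+1;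
  vtx_root : exists r, (forall s c, G s c -> r \notin s) /\
    forall e, e = r \/ exists s c, G s c /\ e \in s }.

Lemma opr_inv s c : opr s c -> s = [:: c] \/ exists t f,
  [/\ G t c, forall e, e \in t -> opr (f e) e & s = flatten (map f t)].
Proof. by case=> [|t d f Gt Hf]; [left | right; exists t, f]. Qed.

Lemma opr_gen t c : G t c -> opr t c.
Proof.
move=> Gt; rewrite -(flatten_id t); apply: opr_vtx => // e _; exact: opr_id.
Qed.

Lemma opr_comp t c (f : E -> seq E) : opr t c -> (forall e, e \in t -> opr (f e) e) ->
  opr (flatten (map f t)) c.
Proof.
elim=> {t c} [c|t c g Gt _ IH] fP; first by rewrite /= cats0; apply: fP; rewrite inE.
have -> : flatten [seq f i | i <- flatten [seq g i | i <- t]] =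
    flatten [seq flatten (map f (g x)) | x <- t].
  elim: t {Gt IH fP} => //= x t <-; by rewrite map_cat flatten_cat.
apply: opr_vtx => // e et; apply: IH => // e' e'g; apply: fP.
by apply/flatten_mapP; exists e.
Qed.

Lemma below_refl c : below c c.
Proof. by exists [:: c]; rewrite ?inE //; apply: opr_id. Qed.

Lemma below_trans y x z : below x y -> below y z -> below x z.
Proof.
move=> [s sy xs] [t tz yt].
exists (flatten [seq if e == y then s else [:: e] | e <- t]).
  by apply: opr_comp => // e _; case: eqP => [->|_] //; apply: opr_id.
by apply/flatten_mapP; exists y; rewrite ?eqxx.
Qed.

Lemma below_vtx t c e : G t c -> e \in t -> below e c.
Proof. by move=> Gt et; exists t => //; apply: opr_gen. Qed.

Lemma below_step e c : below e c ->
  e = c \/ exists s p, [/\ G s p, e \in s & below p c].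
Proof.
case=> s; elim=> {s c} [c|t c f Gt _ IH]; first by rewrite inE => /eqP; left.
move=> /flatten_mapP[x xt /(IH x xt)[->|[s [p [Gs es px]]]]]; right.
  by exists t, c; split=> //; apply: below_refl.
exists s, p; split=> //; exact: below_trans px (below_vtx Gt xt).
Qed.

Hypothesis GT : is_tree.

Section Depth.
Variable d : E -> nat.
Hypothesis dP : forall s c e, G s c -> e \in s -> d e = (d c).+1.

Lemma below_depth e c : below e c -> e = c \/ d c < d e.
Proof.
case=> s; elim=> {s c} [c|t c f Gt _ IH]; first by rewrite inE => /eqP; left.
move=> /flatten_mapP[x xt /(IH x xt)]; rewrite (dP Gt xt) => -[->|/ltnW]; right => //.
by rewrite (dP Gt xt).
Qed.

(** The ancestors of an edge form a chain, on which the depth is injective. *)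
Lemma below_depth_inj e x y : below e x -> below e y -> d x = d y -> x = y.
Proof.
have aux x' y' : below x' y' -> d x' = d y' -> x' = y'.
  by move=> /below_depth[//|lt] eq; rewrite eq ltnn in lt.
have [n] := ubnP (d e); elim: n e => // n IH e en ex ey dxy.
have [exx|[s [p [Gs es px]]]] := below_step ex.
  by rewrite exx in ey; apply: aux.
have [eyy|[s' [p' [Gs' es' py]]]] := below_step ey.
  by rewrite eyy in ex; apply/esym/aux.
have pp := vtx_parent GT Gs Gs' es es'.
apply: (IH p) => //; last by rewrite pp.
by rewrite (dP Gs es) in en.
Qed.
End Depth.

Lemma below_sibling t c e x y : G t c -> x \in t -> y \in t ->
  below e x -> below e y -> x = y.
Proof.
move=> Gt xt yt ex ey; case: (vtx_depth GT) => d dP.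
by apply: (below_depth_inj dP ex ey); rewrite (dP _ _ _ Gt xt) (dP _ _ _ Gt yt).
Qed.

Lemma below_anti x y : below x y -> below y x -> x = y.
Proof.
case: (vtx_depth GT) => d dP /(below_depth dP)[//|lt] /(below_depth dP)[//|].
by rewrite ltnNge ltnW.
Qed.

Lemma vtx_notin t c : G t c -> forall e, e \in t -> ~ below c e.
Proof.
move=> Gt e et ce; have ec := below_anti ce (below_vtx Gt et).
case: (vtx_depth GT) => d dP; have := dP _ _ _ Gt et.
by rewrite -ec => /eqP; rewrite ltn_eqF.
Qed.

Lemma opr_out s c : opr s c -> c \in s -> s = [:: c].
Proof.
move=> /opr_inv[//|[t [f [Gt fP ->]]]] /flatten_mapP[x xt cx].
by case: (vtx_notin Gt xt); exists (f x) => //; apply: fP.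
Qed.

Lemma opr_below s c e : opr s c -> e \in c :: s -> below e c.
Proof. by move=> sc; rewrite inE => /predU1P[->|es]; [apply: below_refl | exists s]. Qed.

Lemma opr_antichain s c : opr s c ->
  forall e e', e \in s -> e' \in s -> below e e' -> e = e'.
Proof.
elim=> {s c} [c e e'|t c f Gt fP IH e e']; first by rewrite !inE => /eqP-> /eqP->.
move=> /flatten_mapP[x xt ex] /flatten_mapP[y yt ey] ee'.
have xy : x = y.
  apply: (@below_sibling t c e) => //; first by exists (f x) => //; apply: fP.
  by apply: below_trans ee' _; exists (f y) => //; apply: fP.
by apply: (IH x) => //; rewrite xy.
Qed.

(** Since distinct children have no common descendant, an operation factored through a vertex
splits its inputs into blocks that can be read off from the inputs alone. *)
Lemma opr_block t c (f : E -> seq E) x : G t c -> (forall e, e \in t -> opr (f e) e) ->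
  x \in t -> f x = [seq e <- flatten (map f t) | `[< below e x >]].
Proof.
move=> Gt fP xt; apply/esym/filter_flatten_block => //; first exact: vtx_uniq GT _ _ Gt.
move=> y b yt bf; have by_ : below b y by exists (f y) => //; apply: fP.
apply/asboolP/eqP => [bx|<-//]; exact: below_sibling Gt yt xt by_ bx.
Qed.

(** An operation of a tree is determined by its output and the set of its inputs: it is a subtree,
and its planar structure is inherited. This rigidity of the order of the inputs is what leaves
only two possibilities for an autoequivalence. *)
Lemma opr_inj s s' c : opr s c -> opr s' c -> s =i s' -> s = s'.
Proof.
move=> sc; elim: sc s' => {s c} [c|t c f Gt fP IH] s' s'c ss'.
  by rewrite (opr_out s'c) // -ss' inE.
have [s'1|[t' [g [Gt' gP s'E]]]] := opr_inv s'c.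
  have cs : c \in flatten (map f t) by rewrite ss' s'1 inE.
  by rewrite s'1; apply: opr_out cs; apply: opr_vtx.
have tt' := vtx_fun GT Gt' Gt; subst t' s'.
congr flatten; apply/eq_in_map => x xt; apply: IH (gP x xt) _ => //.
rewrite (opr_block Gt fP xt) (opr_block Gt gP xt) => e.
by rewrite !mem_filter ss'.
Qed.

(** The operation of a vertex is the universal nontrivial operation into its output: every other
one factors through it. Mutual factorization forces equality, so this property singles it out. *)
Lemma opr_refine_anti s t c f g : opr s c -> opr t c ->
  (forall e, e \in t -> opr (f e) e) -> s = flatten (map f t) ->
  (forall e, e \in s -> opr (g e) e) -> t = flatten (map g s) -> s = t.
Proof.
move=> sc tc fP sE gP tE.
have aux s1 t1 f1 g1 : opr t1 c -> (forall e, e \in t1 -> opr (f1 e) e) ->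
    s1 = flatten (map f1 t1) ->
    (forall e, e \in s1 -> opr (g1 e) e) -> t1 = flatten (map g1 s1) ->
    {subset t1 <= s1}.
  move=> t1c f1P s1E g1P t1E e et; move: (et); rewrite {1}t1E => /flatten_mapP[e' e's eg].
  have ee' : below e e' by exists (g1 e') => //; apply: g1P.
  move: (e's); rewrite {1}s1E => /flatten_mapP[e2 e2t e'f].
  have e'e2 : below e' e2 by exists (f1 e2) => //; apply: f1P.
  have e_e2 := opr_antichain t1c et e2t (below_trans ee' e'e2).
  by rewrite (below_anti ee') // e_e2.
by apply: (opr_inj sc tc) => e; apply/idP/idP; [apply: aux sc gP tE fP sE e | apply: aux tc fP sE gP tE e].
Qed.

Lemma opr_same_set s c s' c' : opr s c -> opr s' c' -> c \notin s -> c' \notin s' ->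
  c :: s =i c' :: s' -> c = c' /\ s = s'.
Proof.
move=> sc s'c' cs c's' e.
have cc' : c = c'.
  by apply: below_anti; [apply: (opr_below s'c'); rewrite -e | apply: (opr_below sc); rewrite e];
    exact: mem_head.
split=> //; subst c'; apply: opr_inj sc s'c' _ => x; have := e x.
by rewrite !inE; case: eqP => [->|_]; rewrite ?(negPf cs) ?(negPf c's').
Qed.

(** Only the output of an operation lies above another of its edges, so two such edges cannot
exist. *)
Lemma opr_no_two_below (I : eqType) (g : I -> E) l s c p q p' q' : injective g ->
  opr s c -> perm_eq (c :: s) (map g l) -> uniq l -> perm_eq l [:: p; q; p'; q'] ->
  below (g p) (g q) -> below (g p') (g q') -> False.
Proof.
move=> g_inj sc csl ul lp pq pq'.
have ing x : x \in [:: p; q; p'; q'] -> g x \in c :: s.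
  by rewrite -(perm_mem lp) (perm_mem csl) => /(map_f g).
have aux x y : x \in c :: s -> y \in c :: s -> x != y -> below x y -> y = c.
  rewrite !inE => /predU1P[->|xs] /predU1P[->|ys] //.
    move=> /eqP cy c_y; case: cy; apply: below_anti => //.
    by apply: (opr_below sc); rewrite inE ys orbT.
  by move=> /eqP xy /(opr_antichain sc xs ys).
have := ul; rewrite (perm_uniq lp) /= !inE !negb_or => /and4P[/and3P[pq1 _ _] /andP[_ qq] pq2 _].
have qc : g q = c by apply: (aux (g p)); rewrite ?(inj_eq g_inj) ?ing // !inE eqxx ?orbT.
have qc' : g q' = c by apply: (aux (g p')); rewrite ?(inj_eq g_inj) ?ing // !inE eqxx ?orbT.
by case/eqP: qq; apply: g_inj; rewrite qc qc'.
Qed.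
End Operations.

Section Morphisms.
Variables (E E' : eqType) (G : seq E -> E -> Prop) (G' : seq E' -> E' -> Prop).
Hypotheses (GT : is_tree G) (GT' : is_tree G').

(** The vertices can be recovered from the relation [opr], through their universal property. *)
Lemma vtx_iso (h : E -> E') (k : E' -> E) : cancel h k -> cancel k h ->
  (forall s c, opr G s c -> opr G' (map h s) (h c)) ->
  (forall s c, opr G' s c -> opr G (map k s) (k c)) ->
  forall s c, G s c -> G' (map h s) (h c).
Proof.
move=> hk kh hP kP s c Gs; have hs := hP _ _ (opr_gen Gs).
have kMh t : map k (map h t) = t by rewrite -map_comp -[RHS]map_id; apply: eq_map.
have hMk t : map h (map k t) = t by rewrite -map_comp -[RHS]map_id; apply: eq_map.
have cs : c \notin s by apply/negP => /(vtx_notin GT Gs); apply; apply: below_refl.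
have [hs1|[t [f [Gt fP hsE]]]] := opr_inv hs.
  case/negP: cs; rewrite -(kMh s) hs1 /= hk; exact: mem_head.
have /opr_inv[kt1|[t' [g [Gt' gP ktE]]]] := kP _ _ (opr_gen Gt).
  have : h c \in t by rewrite -(hMk t) kt1 /= hk mem_head.
  by move=> /(vtx_notin GT' Gt); case; apply: below_refl.
rewrite hk in Gt'; have t's := vtx_fun GT Gt' Gs; subst t'.
suff -> : map h s = t by [].
apply: (@opr_refine_anti _ G' GT' _ _ (h c) f (map h \o g \o k)) => //.
- exact: opr_gen.
- move=> e /mapP[x xs ->] /=; rewrite hk; apply: hP; exact: gP.
- rewrite -(hMk t) ktE map_flatten -!map_comp; congr flatten.
  by apply: eq_map => x /=; rewrite hk.
Qed.

End Morphisms.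

(** An automorphism fixes the root, and the ordering of the children of each vertex propagates
this upwards. *)
Lemma tree_rigid (E : eqType) (G : seq E -> E -> Prop) (h k : E -> E) : is_tree G ->
  cancel h k -> cancel k h ->
  (forall s c, G s c -> G (map h s) (h c)) -> (forall s c, G s c -> G (map k s) (k c)) ->
  h =1 id.
Proof.
move=> GT hk kh hG kG e; have [d dP] := vtx_depth GT; have [r [rP rE]] := vtx_root GT.
have [n] := ubnP (d e); elim: n e => // n IH e en.
have [->|[s [c [Gs es]]]] := rE e.
  have [//|[s [c [Gs rs]]]] := rE (h r).
  by case/negP: (rP _ _ (kG _ _ Gs)); apply/mapP; exists (h r).
have hc : h c = c by apply: IH; move: en; rewrite (dP _ _ _ Gs es).
have := hG _ _ Gs; rewrite hc => /(vtx_fun GT Gs) hs.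
move: (es) => /(nthP e)[i isz ei]; rewrite -{1}ei -(nth_map _ (h e)) // -hs.
by rewrite (set_nth_default e) ?ei.
Qed.

(** * Orientation of a combinatorial tree *)

Section Orientation.
Variable T : tree.
Implicit Types x y : node T.

Lemma adj_sym : symmetric (@adj T).
Proof. by move=> x y; rewrite /adj setUC. Qed.

Lemma adj_neq x y : adj x y -> x != y.
Proof. by move=> /(@branches_card T); rewrite cards2; case: (x != y). Qed.

(** Two simple paths to the output with different first steps would, up to the first node where
they meet, form a cycle. *)
Lemma oriented_fun x y y' : oriented x y -> oriented x y' -> y = y'.
Proof.
move=> [p [pp up lp]] [p' [pp' up' lp']].
have [q1 [z [q2 [yE zy' q1P]]]] : exists q1 z q2,
    [/\ y :: p = q1 ++ z :: q2, z \in y' :: p' & ~~ has (mem (y' :: p')) q1].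
  have hm : has (mem (y' :: p')) (y :: p).
    apply/hasP; exists (output T); first by rewrite -lp mem_last.
    by have := mem_last y' p'; rewrite lp'.
  case: (split_find hm) => z q1 q2 /= zy' q1P.
  by exists q1, z, q2; rewrite cat_rcons.
have [r1 [r2 y'E]] : exists r1 r2, y' :: p' = r1 ++ z :: r2.
  by case/splitPr: zy' => r1 r2; exists r1, r2.
rewrite yE y'E /= cat_path cat_path /= in pp pp' up up' q1P *.
case/and3P: pp => xq1 q1z _; case/and3P: pp' => xr1 r1z _.
have: size (x :: q1 ++ z :: rev r1) <= 2.
  apply: tree_acyclic.
    move: up up'; rewrite !mem_cat !inE !cat_uniq /= !negb_or.
    move=> /and5P[/and3P[xq xz _] uq1 /andP[zq _] _ _].
    move=> /and5P[/and3P[xr _ _] ur1 /andP[zr _] _ _].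
    rewrite mem_cat inE cat_uniq /= !mem_rev !negb_or xq xz xr uq1 zq zr rev_uniq ur1 /= andbT.
    apply: contra q1P => /hasP[u]; rewrite mem_rev => ur uq.
    by apply/hasP; exists u => //=; rewrite mem_cat ur.
  rewrite /= rcons_cat cat_path xq1 /= q1z /=.
  have -> : rcons (rev r1) x = rev (x :: r1) by rewrite rev_cons.
  have := rev_path (@adj T) x (rcons r1 z).
  rewrite last_rcons belast_rcons => ->.
  rewrite (@eq_path _ _ (@adj T)); last by move=> u v; rewrite adj_sym.
  by rewrite rcons_path xr1.
rewrite /= size_cat /= size_rev addnS.
by move: yE y'E; case: (q1) (r1) => [|? ?] [|? ?] //= [-> _] [-> _].
Qed.

(** The simple path from [y] to the output either avoids [x] or starts with the edge to [x], as it
would otherwise close a cycle. *)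
Lemma adj_oriented x y : adj x y -> oriented x y \/ oriented y x.
Proof.
move=> xy; have [p pp lp] := connectP (tree_connected y (output T)).
move: lp; case: (shortenP pp) => q qq uq _ lq.
have [xq|xq] := boolP (x \in y :: q); last first.
  by left; exists q; split=> //=; [rewrite xy | rewrite xq].
right; move: xq; rewrite inE (negPf (adj_neq xy)) /= => xq.
case/splitPr: xq lq qq uq => q1 q2 lq qq uq.
have: size (y :: rcons q1 x) <= 2.
  apply: tree_acyclic; first by move: uq; rewrite -cat_rcons -cat_cons cat_uniq => /andP[].
  by move: qq; rewrite -cat_rcons cat_path => /andP[h _]; rewrite /= rcons_path h last_rcons.
case: q1 lq qq uq => [|? ?] /= lq qq uq; last by rewrite size_rcons.
by exists q2.
Qed.

Lemma oriented_ex x : x != output T -> exists y, oriented x y.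
Proof.
move=> xo; have [p pp lp] := connectP (tree_connected x (output T)).
move: lp; case: (shortenP pp) => -[|y q] qq uq _ /esym lq; first by rewrite -lq eqxx in xo.
by exists y, q.
Qed.

Lemma oriented_adj x y : oriented x y -> adj x y.
Proof. by move=> [p [/andP[]]]. Qed.

Lemma oriented_output y : ~ oriented (output T) y.
Proof. by move=> [p [_ /andP[+ _] lp]]; rewrite -lp mem_last. Qed.

(** By uniqueness of the next node, each node has only one simple path to the output; the depth is
its length. *)
Lemma oriented_depth : exists d : node T -> nat, forall x y, oriented x y -> d x = (d y).+1.
Proof.
pose P x p := [/\ path (@adj T) x p, uniq (x :: p) & last x p = output T].
have exP x : exists p, P x p.
  have [p pp lp] := connectP (tree_connected x (output T)).
  by move: lp; case: (shortenP pp) => q *; exists q.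
have uP p : forall x q, P x p -> P x q -> p = q.
  elim: p => [|y p IH] x [|y' q] // [pp up lp] [qq uq lq].
  - by move: uq lq; rewrite -[in X in _ -> X]lp /= => /andP[xq _] lq; rewrite -lq mem_last in xq.
  - by move: up lp; rewrite -[in X in _ -> X]lq /= => /andP[xq _] lp'; rewrite -lp' mem_last in xq.
  have yy' : y = y' by apply: (@oriented_fun x); [exists p | exists q].
  subst y'; congr cons; apply: (IH y).
    by case/andP: pp; case/andP: up.
  by case/andP: qq; case/andP: uq.
exists (fun x => size (sval (cid (exP x)))) => x y xy.
case: (cid (exP x)) => p px /=; case: (cid (exP y)) => q qy /=.
case: xy => r [pr ur lr]; rewrite (uP _ _ _ px (And3 pr ur lr)) /=; congr S; congr size.
by apply: uP qy; case/andP: pr; case/andP: ur.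
Qed.

Lemma oriented_asym x y : oriented x y -> ~ oriented y x.
Proof.
have [d dP] := oriented_depth => /dP xy /dP yx.
by move: xy; rewrite yx => /eqP; rewrite ltn_eqF // ltnW.
Qed.

Lemma edge_oriented (e : edge T) : exists x y, oriented x y /\ sval e = [set x; y].
Proof.
case: e => A Ab /=; have /eqP/cards2P[x [y [xy AE]]] := branches_card Ab.
have /adj_oriented[o|o] : adj x y by rewrite /adj -AE.
  by exists x, y.
by exists y, x; rewrite setUC.
Qed.

Lemma oriented_inj x y x' y' : oriented x y -> oriented x' y' ->
  [set x; y] = [set x'; y'] -> x = x' /\ y = y'.
Proof.
move=> xy x'y' /setP e.
have xx' : x = x'.
  move: (e x); rewrite !inE eqxx => /esym/orP[/eqP//|/eqP xy'].
  move: (e y); rewrite !inE eqxx orbT => /esym/orP[/eqP yx'|/eqP yy'].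
    by case: (oriented_asym xy); rewrite yx' xy'.
  by have := adj_neq (oriented_adj xy); rewrite yy' xy' eqxx.
by split=> //; apply: oriented_fun xy _; rewrite xx'.
Qed.
End Orientation.

(** * Edges and vertices of a planar tree *)

(** The endpoints of an edge, with the orientation towards the output. Sending an edge to its source
is a bijection onto the nodes other than the output, which turns statements about the graph into
statements about edges. *)
Definition src (T : tree) (e : edge T) : node T := sval (cid (edge_oriented e)).
Definition tgt (T : tree) (e : edge T) : node T := sval (cid (svalP (cid (edge_oriented e)))).

Section EndPoints.
Variable T : tree.
Implicit Types (e : edge T) (x y : node T).

Lemma oriented_src e : oriented (src e) (tgt e).
Proof. exact: (proj1 (svalP (cid (svalP (cid (edge_oriented e)))))). Qed.

Lemma edgeE e : sval e = [set src e; tgt e].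
Proof. exact: (proj2 (svalP (cid (svalP (cid (edge_oriented e)))))). Qed.

Lemma src_tgtE e x y : oriented x y -> sval e = [set x; y] -> src e = x /\ tgt e = y.
Proof. by move=> xy; rewrite edgeE; apply: oriented_inj => //; apply: oriented_src. Qed.

Lemma src_inj : injective (@src T).
Proof.
move=> e e' ee'; apply: val_inj; rewrite /= !edgeE ee'; congr [set _; _].
by apply: oriented_fun (oriented_src e) _; rewrite ee'; apply: oriented_src.
Qed.

Lemma src_output e : src e != output T.
Proof. by apply: contraPneq (oriented_src e) => ->; apply: oriented_output. Qed.

Lemma src_surj x : x != output T -> exists e, src e = x.
Proof.
move=> /oriented_ex[y xy]; exists (exist _ [set x; y] (oriented_adj xy)).
by case: (@src_tgtE (exist _ [set x; y] (oriented_adj xy)) _ _ xy erefl).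
Qed.

Lemma outer_edge e e' x : outer x -> x \in sval e -> x \in sval e' -> e = e'.
Proof.
move=> /cards1P[A AE] xe xe'.
have aux (e0 : edge T) : x \in sval e0 -> sval e0 = A.
  by move=> h; apply/set1P; rewrite -AE inE h (svalP e0).
by apply: val_inj; rewrite /= (aux e xe) (aux e' xe').
Qed.

(** A node that some edge enters has a second edge, its output, so it is not outer. *)
Lemma tgt_vertex e : tgt e != output T -> (tgt e \notin inputs T) && (tgt e != output T).
Proof.
move=> to; rewrite to andbT; apply/negP => /inputs_outer oe.
have [e' e'E] := src_surj to.
have : e = e' by apply: (outer_edge oe); rewrite edgeE ?e'E !inE eqxx ?orbT.
move=> ee'; have := oriented_src e; rewrite -e'E -ee' => h.
by have := oriented_asym h.
Qed.
End EndPoints.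

Definition gen (T : planar_tree) (s : seq (edge T)) (e : edge T) : Prop :=
  inhabited (vertex_gen s e).

Section Generators.
Variable T : planar_tree.
Implicit Types (e f : edge T) (v : vertex T).

Lemma input_edges_tgt v e : e \in input_edges v <-> tgt e = sval v.
Proof.
rewrite input_edgesP; split=> [[w [wv eE]]|tv]; first by case: (src_tgtE wv eE).
by exists (src e); rewrite -tv; split; [apply: oriented_src | apply: edgeE].
Qed.

Lemma output_edge_src v e : is_output_edge v e <-> src e = sval v.
Proof.
split=> [[w [wv eE]]|sv]; first by case: (src_tgtE wv eE).
by exists (tgt e); rewrite -sv; split; [apply: oriented_src | apply: edgeE].
Qed.

Lemma genP s e : gen s e <-> exists v, input_edges v = s /\ src e = sval v.
Proof.
split=> [[[v [vs /output_edge_src h]]]|[v [vs /output_edge_src h]]]; first by exists v.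
by constructor; exists v.
Qed.

Lemma gen_tgt s c e : gen s c -> e \in s -> tgt e = src c.
Proof. by move=> /genP[v [<- ->]] /input_edges_tgt. Qed.

Lemma gen_exists e : tgt e != output T -> exists s c, gen s c /\ e \in s.
Proof.
move=> te; pose v : vertex T := exist (fun x => (x \notin inputs T) && (x != output T)) _ (tgt_vertex te).
have [c cE] := src_surj te.
exists (input_edges v), c; split; first by apply/genP; exists v.
exact/input_edges_tgt.
Qed.

Lemma gen_is_tree : is_tree (@gen T).
Proof.
split.
- move=> s s' c /genP[v [<- vc]] /genP[v' [<- v'c]]; congr input_edges.
  by apply: val_inj; rewrite /= -vc.
- by move=> s c /genP[v [<- _]]; apply: input_edges_uniq.
- by move=> s s' c c' e Gc Gc' /(gen_tgt Gc) h /(gen_tgt Gc'); rewrite h => /src_inj.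
- have [d dP] := oriented_depth T; exists (fun e => d (src e)) => s c e Gc /(gen_tgt Gc) <-.
  exact/dP/oriented_src.
- have /cards1P[A AE] := output_outer T.
  have /[!inE] /andP[Ab oA] : A \in [set A in branches T | output T \in A] by rewrite AE set11.
  exists (exist (fun A => A \in branches T) A Ab).
  have rE : tgt (exist (fun A => A \in branches T) A Ab) = output T.
    set r := exist _ A Ab; have : output T \in sval r by [].
    by rewrite edgeE => /set2P[/eqP|//]; rewrite eq_sym (negPf (src_output r)).
  split=> [s c Gc|e].
    apply/negP => /(gen_tgt Gc); rewrite rE => /esym/eqP.
    by rewrite (negPf (src_output c)).
  have [te|/gen_exists] := eqVneq (tgt e) (output T); [left | by right].
  apply: (@outer_edge T _ _ (output T)) => //; first exact: output_outer.
  by rewrite edgeE -te !inE eqxx orbT.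
Qed.

Lemma vertex_gen_irr s e (x y : @vertex_gen T s e) : x = y.
Proof.
case: x y => v [iv ov] [w [iw ow]]; apply: eq_exist; apply: val_inj.
by rewrite /= -(proj1 (output_edge_src v e) ov) -(proj1 (output_edge_src w e) ow).
Qed.
End Generators.

(** A planar tree is determined by its edges and generators: a node other than the output is
the source of exactly one edge. *)
Lemma isomorphic_of_edges (S T : planar_tree) (h : edge S -> edge T) (k : edge T -> edge S) :
  cancel h k -> cancel k h ->
  (forall s c, gen s c -> gen (map h s) (h c)) ->
  (forall s c, gen s c -> gen (map k s) (k c)) -> isomorphic S T.
Proof.
have ext (A B : planar_tree) (p : edge A -> edge B) : exists f : node A -> node B,
    f (output A) = output B /\ forall e, f (src e) = src (p e).
  have /choice[f fP] : forall x, exists y, (x = output A -> y = output B) /\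
      forall e, src e = x -> src (p e) = y.
    move=> x; have [->|/src_surj[e <-]] := eqVneq x (output A).
      by exists (output B); split=> // e /eqP; rewrite (negPf (src_output e)).
    by exists (src (p e)); split=> [/eqP|e' /src_inj-> //]; rewrite (negPf (src_output e)).
  by exists f; split=> [|e]; [apply: (proj1 (fP _)) | apply/esym/(proj2 (fP _))].
have edges (A B : planar_tree) (p : edge A -> edge B) (q : edge B -> edge A) (f : node A -> node B) :
    cancel p q ->
    (forall s c, gen s c -> gen (map p s) (p c)) ->
    (forall s c, gen s c -> gen (map q s) (q c)) ->
    f (output A) = output B -> (forall e, f (src e) = src (p e)) ->
    forall e : edge A, f @: sval e = sval (p e).
  move=> pq pG qG fo fs e; rewrite !edgeE imsetU !imset_set1 fs; congr [set _; _].
  have [te|/gen_exists[s [c [Gc es]]]] := eqVneq (tgt e) (output A); last first.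
    by rewrite (gen_tgt Gc es) fs (gen_tgt (pG _ _ Gc)) // map_f.
  rewrite te fo; have [//|/gen_exists[s [c [Gc es]]]] := eqVneq (tgt (p e)) (output B).
  have : e \in map q s by apply/mapP; exists (p e).
  by move=> /(gen_tgt (qG _ _ Gc)); rewrite te => /esym/eqP; rewrite (negPf (src_output _)).
have cancel_ext (A B : planar_tree) (p : edge A -> edge B) (q : edge B -> edge A) f g :
    cancel p q -> f (output A) = output B -> (forall e, f (src e) = src (p e)) ->
    g (output B) = output A -> (forall e, g (src e) = src (q e)) -> cancel f g.
  move=> pq fo fs go gs x; have [->|/src_surj[e <-]] := eqVneq x (output A).
    by rewrite fo go.
  by rewrite fs gs pq.
move=> hk kh hG kG; have [f [fo fs]] := ext _ _ h; have [g [go gs]] := ext _ _ k.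
have fe := edges _ _ _ _ _ hk hG kG fo fs; have ge := edges _ _ _ _ _ kh kG hG go gs.
have fg := cancel_ext _ _ _ _ _ _ hk fo fs go gs.
have gf := cancel_ext _ _ _ _ _ _ kh go gs fo fs.
have gfs (A : {set node S}) : g @: (f @: A) = A.
  by rewrite -imset_comp -[RHS]imset_id; apply: eq_imset.
(* an input node is the source of an edge that is not the output of a vertex *)
have inp (A B : planar_tree) (p : edge A -> edge B) (q : edge B -> edge A) (u : node A -> node B) :
    cancel p q -> (forall s c, gen s c -> gen (map q s) (q c)) ->
    u (output A) = output B -> (forall e, u (src e) = src (p e)) ->
    forall x, x \in inputs A -> u x \in inputs B.
  move=> pq qG uo us x xi; have xo : x != output A.
    by apply: contraTneq xi => ->; apply: output_notin_inputs.
  have [e eE] := src_surj xo; subst x; rewrite us; apply/negPn/negP => ni.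
  pose v : vertex B := exist (fun x => (x \notin inputs B) && (x != output B)) (src (p e))
    (introT andP (conj ni (src_output (p e)))).
  have /qG : gen (input_edges v) (p e) by apply/genP; exists v.
  by rewrite pq => /genP[w [_ we]]; case: w we => w /= /andP[+ _] we; rewrite -we xi.
exists f; split=> //; first by exists g.
- move=> A; apply/idP/idP => Ab.
    rewrite -(gfs A) -[f @: A]/(sval (exist (fun A => A \in branches T) _ Ab)) ge.
    by case: (k _).
  by rewrite -[A]/(sval (exist (fun A => A \in branches S) _ Ab)) fe; case: (h _).
- apply/setP => y; apply/imsetP/idP => [[x xi ->]|yi].
    exact: (inp _ _ _ _ _ hk kG fo fs).
  by exists (g y) => //; apply: (inp _ _ _ _ _ kh hG go gs).
- move=> v w vw; have [c cE] : exists c, src c = sval v by apply: src_surj; case/andP: (svalP v).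
  have Gv : gen (input_edges v) c by apply/genP; exists v.
  have Gw : gen (input_edges w) (h c) by apply/genP; exists w; rewrite -fs cE.
  rewrite (vtx_fun (gen_is_tree T) Gw (hG _ _ Gv)) -map_comp; apply: eq_map => e /=; exact: fe.
Qed.

(** * Maps of tree operads *)

Section ThinFree.
Variables (E : eqType) (G : seq E -> E -> Type).
Let Gp s c : Prop := inhabited (G s c).
Hypotheses (GT : is_tree Gp) (Girr : forall s c (x y : G s c), x = y).

Lemma opr_fterm s c : fterm G s c -> opr Gp s c.
Proof.
elim/fterm_elim => {s c} [c|s t c g us IH]; first exact: opr_id.
have Gg : Gp t c by [].
suff [f fP ->] : exists2 f, forall e, e \in t -> opr Gp (f e) e & s = flatten (map f t).
  exact: opr_vtx.
have ut := vtx_uniq GT Gg;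
elim: us IH ut {g Gg} => {s t} [_ _|a d b t u us IH [ad /IH{}IH] /= /andP[dt /IH[f fP ->]]].
  by exists (fun _ => [::]).
exists (fun e => if e == d then a else f e) => [e|].
  by rewrite inE; case: eqP => [->//|_]; apply: fP.
rewrite eqxx; congr (_ ++ flatten _); apply/eq_in_map => e et.
by case: eqP et dt => // -> ->.
Qed.

Lemma fterm_opr s c : opr Gp s c -> inhabited (fterm G s c).
Proof.
elim=> {s c} [c|t c f [g] _ IH]; first by constructor; apply: fvar.
suff [us] : inhabited (forest (fterm G) (flatten (map f t)) t) by constructor; apply: fnode g us.
elim: t IH {g} => [|d t IHt] IH; first by constructor; apply: fnil.
have [x] := IH d (mem_head _ _).
have [us] : inhabited (forest (fterm G) (flatten (map f t)) t).
  by apply: IHt => e et; apply: IH; rewrite inE et orbT.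
by constructor; apply: fcons x us.
Qed.

Lemma fterm_case s c (y : fterm G s c) :
  tot y = tot (fvar G c) \/ exists t (g : G t c) us, y = fnode g us.
Proof. by case: y => [d|s' t d g us]; [left | right; exists t, g, us]. Qed.

Lemma forest_below s t e : forest (fterm G) s t -> e \in s -> exists2 x, x \in t & below Gp e x.
Proof.
elim=> {s t} // a c b t x _ IH; rewrite mem_cat => /orP[ea|/IH[y yt ey]].
  by exists c; [apply: mem_head | exists a => //; apply: opr_fterm].
by exists y => //; rewrite inE yt orbT.
Qed.

(** In an operation that ends with a given vertex, the inputs plugged into the subtree above a child
are those that descend from that child, so the list of all inputs determines the decomposition. *)
Lemma fterm_irr s c (x y : fterm G s c) : x = y.
Proof.
have nvtx t d (g : G t d) : forest (fterm G) [:: d] t -> False.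
  move=> /forest_below/(_ (mem_head _ _))[e et de].
  by have Gg : Gp t d by []; exact: vtx_notin GT _ _ Gg _ et de.
elim/fterm_elim: s c / x y => [c|s t c g us IH] y.
  case: (fterm_case y) => [/tot_inj->//|[t [g [us _]]]]; by case: (nvtx _ _ g us).
case: (fterm_case y) => [/(congr1 (@projT1 _ _))[sc]|[t' [g' [us' ->]]]].
  by case: (nvtx _ _ g); rewrite -sc.
have tt' : t = t'.
  by apply: (vtx_fun GT); [exact: (inhabits g) | exact: (inhabits g')].
subst t'; rewrite (Girr g' g); congr fnode.
have Gg : Gp t c by [].
have disj : forall e x z, x \in t -> z \in t -> below Gp e x -> below Gp e z -> x = z.
  by move=> e x z xt zt; apply: (below_sibling GT Gg).
have ut := vtx_uniq GT Gg.
elim: us IH us' disj ut {g g' y Gg} => {s t}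
  [_ us' _ _|a d b t u us IHus [uP usP] us' disj /= /andP[dt ut]].
  by apply: totf_inj; rewrite totf_nil.
have [a' [b' [u' [f']]]] := fconsP us'.
have blk a0 b0 (u0 : fterm G a0 d) (f0 : forest (fterm G) b0 t) :
    a0 = [seq e <- a0 ++ b0 | `[< below Gp e d >]].
  have h1 : {in a0, (fun e => `[< below Gp e d >]) =1 predT}.
    by move=> e ea; apply/asboolP; exists a0 => //; apply: opr_fterm.
  have h2 : {in b0, (fun e => `[< below Gp e d >]) =1 pred0}.
    move=> e eb; apply/asboolP => ed; have [z zt ez] := forest_below f0 eb.
    by move: dt; rewrite (disj e d z) ?mem_head ?inE ?zt ?orbT.
  by rewrite filter_cat (eq_in_filter h1) (eq_in_filter h2) filter_predT filter_pred0 cats0.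
move=> E1; have := congr1 (@projT1 _ _) E1 => /= -[ab].
have aa' : a = a' by rewrite (blk _ _ u us) (blk _ _ u' f') ab.
have bb' : b = b' by move/eqP: ab; rewrite aa' eqseq_cat // => /andP[_ /eqP].
subst a' b'; apply: totf_inj; rewrite E1; apply: totf_cons; first by rewrite (uP u').
by rewrite (IHus usP f') // => e x z xt zt; apply: disj; rewrite inE ?xt ?zt orbT.
Qed.
End ThinFree.

Section TreeMaps.
Implicit Types S T : planar_tree.

Lemma opr_op T s c : opr (@gen T) s c <-> inhabited (@op (tree_operad T) s c).
Proof.
split; first exact: (@fterm_opr _ (@vertex_gen T)).
by case; apply: (@opr_fterm _ (@vertex_gen T)); apply: gen_is_tree.
Qed.

Lemma tree_map_opr S T (f : operad_map (tree_operad S) (tree_operad T)) s c :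
  opr (@gen S) s c -> opr (@gen T) (map f s) (f c).
Proof. by move=> /opr_op[x]; apply/opr_op; constructor; exact: (Defs.omap f x). Qed.

(** Operations of [tree_operad T] are determined by their colours, so a map into it is too. *)
Lemma tree_map_eq P T (f g : operad_map P (tree_operad T)) : cmap f =1 cmap g -> f = g.
Proof.
move=> fg; apply: operad_map_eq => // s c x.
move: (Defs.omap f x) (Defs.omap g x); rewrite (eq_map fg) fg => u v; congr tot.
exact: (@fterm_irr _ (@vertex_gen T) (gen_is_tree T) (@vertex_gen_irr T)).
Qed.

(** Conversely, a map of edges is realized as soon as it sends vertices to operations, by the
universal property of the free operad. *)
Lemma tree_map_ex S T (h : edge S -> edge T) :
  (forall s c, gen s c -> opr (@gen T) (map h s) (h c)) ->
  exists f : operad_map (tree_operad S) (tree_operad T), cmap f = h.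
Proof.
move=> hP; have hG s c : vertex_gen s c -> @op (tree_operad T) (map h s) (h c).
  move=> x; apply: (sval (cid (_ : exists y : @op (tree_operad T) (map h s) (h c), True))).
  by have /hP/opr_op[y] : gen s c by []; exists y.
by exists (@free_ext_map _ (@vertex_gen S) (tree_operad T) h hG).
Qed.

Lemma tree_iso_gen S T (f : @hom Op_ns (tree_operad S) (tree_operad T))
    (g : @hom Op_ns (tree_operad T) (tree_operad S)) : are_inverse f g ->
  [/\ cancel (cmap f) (cmap g), cancel (cmap g) (cmap f) &
      forall s c, gen s c -> gen (map (cmap f) s) (cmap f c)].
Proof.
case=> gf fg; have fgK : cancel (cmap f) (cmap g)
  by move=> x; apply: (congr1 (fun u : operad_map _ _ => u x) gf).
have gfK : cancel (cmap g) (cmap f) by move=> x; apply: (congr1 (fun u : operad_map _ _ => u x) fg).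
split=> //; apply: (vtx_iso (gen_is_tree S) (gen_is_tree T) fgK gfK) => s c.
  exact: tree_map_opr.
exact: tree_map_opr.
Qed.

Lemma tree_iso_isomorphic S T (f : @hom Op_ns (tree_operad S) (tree_operad T)) :
  is_isom f -> isomorphic S T.
Proof.
case=> g fg; have [fK gK fG] := tree_iso_gen fg.
have [|_ _ gG] := @tree_iso_gen _ _ g f; first by case: fg.
exact: isomorphic_of_edges fK gK fG gG.
Qed.

Lemma tree_auto_id T (f : @hom Op_ns (tree_operad T) (tree_operad T)) : is_isom f -> f = idm _.
Proof.
case=> g fg; have [fK gK fG] := tree_iso_gen fg.
have [|_ _ gG] := @tree_iso_gen _ _ g f; first by case: fg.
by apply: tree_map_eq; apply: tree_rigid (gen_is_tree T) fK gK fG gG.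
Qed.
End TreeMaps.

(** * Trees defined by a parent function *)

(** The test trees below are described by the parent function [q] on the edges [0, ..., N], edge 0
being the root edge and parents having smaller numbers. Node [j.+1] is the source of edge [j], and
node 0 is the output. The children of an edge are ordered by their numbers. *)
Section ParentTree.
Variables (N : nat) (q : nat -> nat) (leaf : pred nat).
Hypothesis q_lt : forall j, 0 < j -> q j < j.
Hypothesis q_leaf : forall j, 0 < j <= N -> ~~ leaf (q j).

Let V := 'I_N.+2.
Implicit Types x y : V.

Definition up_nat (n : nat) : nat := if n is j.+1 then (if j is 0 then 0 else (q j).+1) else 0.

Lemma up_nat_lt n : 0 < n -> up_nat n < n.
Proof. by case: n => // -[|j] _ //=; rewrite ltnS q_lt. Qed.

Lemma up_nat_ord x : up_nat x < N.+2.
Proof.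
case: (posnP x) => [->//|x0]; exact: ltn_trans (up_nat_lt x0) (ltn_ord x).
Qed.

Definition up x : V := Ordinal (up_nat_ord x).

Lemma up_lt x : x != ord0 -> up x < x.
Proof. by rewrite -val_eqE /= -lt0n => /up_nat_lt. Qed.

Definition parent_branches : {set {set V}} := [set [set x; up x] | x in [set~ ord0]].

Lemma parent_branchP (A : {set V}) :
  reflect (exists2 x, x != ord0 & A = [set x; up x]) (A \in parent_branches).
Proof.
by apply: (iffP imsetP) => -[x]; [rewrite in_setC1 | ]; exists x; rewrite ?in_setC1.
Qed.

Lemma parent_branches_card (A : {set V}) : A \in parent_branches -> #|A| = 2.
Proof.
move=> /parent_branchP[x x0 ->]; rewrite cards2; case: eqP => // xx.
by have := up_lt x0; rewrite -xx ltnn.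
Qed.

Let padj x y := [set x; y] \in parent_branches.

Lemma parent_adj_sym : symmetric padj.
Proof. by move=> x y; rewrite /padj setUC. Qed.

Lemma parent_adj_up x : x != ord0 -> padj x (up x).
Proof. by move=> x0; apply/parent_branchP; exists x. Qed.

Lemma parent_adjE x y : padj x y -> y <= x -> x != ord0 /\ y = up x.
Proof.
move=> /parent_branchP[z z0 /setP e] yx; have zlt := up_lt z0.
have xz : x \in [set z; up z] by rewrite -e !inE eqxx.
have yz : y \in [set z; up z] by rewrite -e !inE eqxx orbT.
have zx : z \in [set x; y] by rewrite e !inE eqxx.
have uzx : up z \in [set x; y] by rewrite e !inE eqxx orbT.
case/set2P: zx => zE; first subst z.
  split=> //; case/set2P: uzx => // ux; by rewrite ux ltnn in zlt.
subst z; case/set2P: xz => [xy|xy]; last by rewrite xy leqNgt zlt in yx.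
subst y; split=> //; case/set2P: uzx => ux; by rewrite ux ltnn in zlt.
Qed.

(** Nodes are numbered so that parents come before their children, and descending to the
parents gives a simple path to node 0. *)
Lemma parent_path x : exists p,
  [/\ path padj x p, uniq (x :: p), last x p = ord0 & forall z, z \in p -> z < x].
Proof.
have [n] := ubnP (x : nat); elim: n x => // n IH x xn.
have [->|x0] := eqVneq x ord0; first by exists [::].
have [|p [pp up_ lp pl]] := IH (up x); first exact: leq_trans (up_lt x0) xn.
have lt z : z \in up x :: p -> z < x.
  by rewrite inE => /predU1P[->|/pl /ltn_trans]; [|apply]; apply: up_lt.
exists (up x :: p); split=> //.
  by rewrite /= parent_adj_up.
rewrite cons_uniq up_ andbT; apply/negP => /lt; by rewrite ltnn.
Qed.

Lemma parent_connected x y : connect padj x y.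
Proof.
have c0 z : connect padj z ord0.
  by have [p [pp _ lp _]] := parent_path z; apply/connectP; exists p.
by apply: connect_trans (c0 x) _; rewrite (sym_connect_sym parent_adj_sym).
Qed.

(** In a cycle, both neighbours of the largest node would be its parent. *)
Lemma parent_acyclic c : uniq c -> cycle padj c -> size c <= 2.
Proof.
move=> uc cc; rewrite leqNgt; apply/negP => sc.
have [m mc mM] : exists2 m, m \in c & forall z, z \in c -> z <= m.
  case: c sc {uc cc} => // a c _;
  case: (@arg_maxnP _ a [in a :: c] (@nat_of_ord _) (mem_head _ _)) => m mc mM.
  by exists m.
case: (rot_to mc) => i c' rc.
move: uc cc sc; rewrite -(rot_uniq i) -(rot_cycle i) -(size_rot i) rc.
have {mM} : forall z, z \in c' -> z <= m.
  by move=> z zc; apply: mM; rewrite -(mem_rot i) rc inE zc orbT.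
case: c' rc => // a c' _ mM /= /and3P[_ ac _]; rewrite rcons_path => /and3P[ma _ bm] sc.
case: (parent_adjE ma (mM _ (mem_head _ _))) => _ aE.
rewrite -[padj _ _]/(padj _ _) parent_adj_sym in bm.
case: (parent_adjE bm (mM _ (mem_last _ _))) => _; rewrite -aE.
by case: c' sc ac {mM bm} => //= b c' _ ac ba; rewrite -ba mem_last in ac.
Qed.

Definition parent_graph : combinatorial_tree :=
  @CombinatorialTree V parent_branches parent_branches_card
    (eq_ind_r (fun n => 0 < n) (ltn0Sn _) (card_ord N.+2)) parent_connected parent_acyclic.

Lemma outer_of_up (x y : V) : y != ord0 -> x \in [set y; up y] ->
  (forall z, z != ord0 -> x \in [set z; up z] -> z = y) -> @outer parent_graph x.
Proof.
move=> y0 xy yP; apply/cards1P; exists [set y; up y]; apply/setP => A; rewrite !inE.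
apply/andP/eqP => [[/parent_branchP[z z0 ->] /(yP _ z0)->//]|->].
by split=> //; apply/parent_branchP; exists y.
Qed.

Lemma parent_output_outer : @outer parent_graph ord0.
Proof.
apply: (@outer_of_up _ (Ordinal (isT : 1 < N.+2))) => //.
  by apply/set2P; right; apply: val_inj.
move=> z z0 /set2P[zE|/(congr1 val) /=]; first by rewrite -zE eqxx in z0.
case: z z0 => -[|[|z]] zN //= _ _; exact: val_inj.
Qed.

Definition parent_inputs : {set V} := [set x | (x != ord0) && leaf x.-1].

Lemma parent_inputs_outer (x : V) : x \in parent_inputs -> @outer parent_graph x.
Proof.
rewrite inE => /andP[x0 lx]; apply: (outer_of_up x0); first by rewrite !inE eqxx.
move=> z z0 /set2P[->//|/(congr1 val) /=]; case: z z0 => -[|[|z]] zN //= _ xE.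
  by rewrite -val_eqE /= xE in x0.
by move: lx; rewrite xE /= (negPf (q_leaf _)).
Qed.

Lemma parent_output_notin : ord0 \notin parent_inputs.
Proof. by rewrite inE eqxx. Qed.

Definition parent_tree : tree :=
  @Tree parent_graph ord0 parent_inputs parent_output_outer parent_inputs_outer parent_output_notin.

Lemma parent_oriented x y : @oriented parent_tree x y <-> x != ord0 /\ y = up x.
Proof.
have up_or z : z != ord0 -> @oriented parent_tree z (up z).
  move=> z0; have [p [pp uq lp pl]] := parent_path (up z); exists p; split=> //.
    by apply/andP; split=> //; apply: parent_adj_up.
  have zu : up z < z := up_lt z0.
  rewrite cons_uniq uq andbT inE negb_or -val_eqE /= gtn_eqF //=.
  by apply/negP => /pl /ltn_trans /(_ zu); rewrite ltnn.
split=> [xy|[x0 ->]]; last exact: up_or.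
have x0 : x != ord0 by apply: contraPneq xy => ->; apply: (@oriented_output parent_tree).
by split=> //; apply: (@oriented_fun parent_tree) xy (up_or _ x0).
Qed.

(** The values at [j > N] are arbitrary. *)
Definition pnode j : V := inord (minn j N).+1.

Lemma pnode_val j : j <= N -> pnode j = j.+1 :> nat.
Proof. by move=> jN; rewrite /pnode (minn_idPl jN) inordK // !ltnS. Qed.

Lemma pnode_neq0 j : pnode j != ord0.
Proof. by rewrite -val_eqE /= inordK // !ltnS geq_minr. Qed.

Lemma pnode_up_branch j : [set pnode j; up (pnode j)] \in parent_branches.
Proof. by apply/parent_branchP; exists (pnode j); rewrite ?pnode_neq0. Qed.

Definition plabel j : edge parent_tree :=
  exist (fun A => A \in branches parent_tree) _ (pnode_up_branch j).

Lemma plabel_src j : src (plabel j) = pnode j /\ tgt (plabel j) = up (pnode j).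
Proof. by apply: src_tgtE => //; apply/parent_oriented; split=> //; apply: pnode_neq0. Qed.

Lemma plabel_inj i j : i <= N -> j <= N -> plabel i = plabel j -> i = j.
Proof.
move=> iN jN /(congr1 (@src _)); rewrite !(proj1 (plabel_src _)) => /(congr1 val).
by rewrite /= !pnode_val // => -[].
Qed.

Lemma plabel_surj (e : edge parent_tree) : exists2 j, j <= N & e = plabel j.
Proof.
case: e => A Ab; have /parent_branchP[x x0 AE] := Ab; exists x.-1.
  by case: x x0 {AE} => -[|x].
apply: val_inj; rewrite /= AE; suff -> : pnode x.-1 = x by [].
by apply: val_inj; rewrite /= pnode_val; case: x x0 {AE} => -[|x].
Qed.

Definition children i := [seq j <- iota 1 N | q j == i].

Lemma mem_children i j : (j \in children i) = [&& 0 < j, j <= N & q j == i].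
Proof. by rewrite mem_filter mem_iota add1n ltnS andbC andbA. Qed.

Definition parent_input_edges (v : vertex parent_tree) : seq (edge parent_tree) :=
  [seq plabel j | j <- children (sval v : V).-1].

Lemma parent_input_uniq v : uniq (parent_input_edges v).
Proof.
rewrite map_inj_in_uniq ?filter_uniq ?iota_uniq // => i j.
by rewrite !mem_children => /and3P[_ iN _] /and3P[_ jN _]; apply: plabel_inj.
Qed.

Lemma parent_inputP v e : e \in parent_input_edges v <-> is_input_edge v e.
Proof.
have v0 : (sval v : V) != ord0 by case: v => v /= /andP[].
split=> [/mapP[j]|[w [/parent_oriented[w0 vE] eE]]].
  rewrite mem_children => /and3P[j0 jN /eqP qj] ->; exists (pnode j).
  have -> : sval v = up (pnode j).
    apply: val_inj; rewrite /= pnode_val //; case: j j0 jN qj => // j _ _ /= ->.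
    by case: (sval v : V) v0 => -[|?].
  by split=> //; apply/parent_oriented; split=> //; apply: pnode_neq0.
have [j jN ej] := plabel_surj e; subst e; apply/map_f; rewrite mem_children jN.
have : src (plabel j) = w /\ tgt (plabel j) = sval v.
  by apply: src_tgtE => //; apply/parent_oriented.
rewrite !(proj1 (plabel_src j)) !(proj2 (plabel_src j)) => -[_ /(congr1 val)].
rewrite /= pnode_val //; case: j jN {eE} => [|j] jN /=.
  by move=> h; case/eqP: v0; apply: val_inj.
by move=> <-; rewrite /= eqxx.
Qed.

Definition parent_planar : planar_tree :=
  @PlanarTree parent_tree parent_input_edges parent_input_uniq parent_inputP.

Lemma parent_gen s (e : edge parent_planar) : gen s e <->
  exists2 i, i <= N /\ ~~ leaf i & e = plabel i /\ s = map plabel (children i).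
Proof.
split=> [/genP[v [<- ve]]|[i [iN li] [-> ->]]].
  have [i iN eE] := plabel_surj e; subst e; exists i; rewrite (proj1 (plabel_src i)) in ve.
    split=> //; case: v ve => v /= /andP[vi _] ve; move: vi.
    by rewrite -ve inE pnode_neq0 pnode_val.
  by split=> //; rewrite /input_edges /= /parent_input_edges -ve pnode_val.
have vP : (pnode i \notin inputs parent_tree) && (pnode i != output parent_tree).
  by rewrite inE pnode_neq0 pnode_val // li.
apply/genP; exists (exist (fun x => (x \notin inputs parent_tree) && (x != output parent_tree)) _ vP).
split; last exact: (proj1 (plabel_src i)).
by rewrite /input_edges /= /parent_input_edges /= pnode_val.
Qed.
End ParentTree.

(** * The category of planar trees and some of its objects *)

Definition edges (K : Omega_ns) := edge (repr_tree K).
Definition Gen (K : Omega_ns) : seq (edges K) -> edges K -> Prop := @gen (repr_tree K).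
Definition Opr (K : Omega_ns) : seq (edges K) -> edges K -> Prop := opr (@Gen K).
Definition on_edges (K L : Omega_ns) (f : hom K L) : edges K -> edges L := cmap f.

Lemma Gen_tree K : is_tree (@Gen K). Proof. exact: gen_is_tree. Qed.

Section OnEdges.
Implicit Types K L : Omega_ns.

Lemma on_edges_comp K L X (g : hom L X) (f : hom K L) e :
  on_edges (mcomp g f) e = on_edges g (on_edges f e).
Proof. by []. Qed.

Lemma on_edges_inj K L (f g : hom K L) : on_edges f =1 on_edges g -> f = g.
Proof. exact: (@tree_map_eq (tree_operad (repr_tree K)) (repr_tree L) f g). Qed.

Lemma on_edges_Opr K L (f : hom K L) s c : Opr s c -> Opr (map (on_edges f) s) (on_edges f c).
Proof. exact: (@tree_map_opr (repr_tree K) (repr_tree L) f). Qed.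

Lemma on_edges_ex K L (h : edges K -> edges L) :
  (forall s c, Gen s c -> Opr (map h s) (h c)) -> exists f : hom K L, on_edges f = h.
Proof. exact: (@tree_map_ex (repr_tree K) (repr_tree L)). Qed.

Lemma on_edges_inverse K L (f : hom K L) (g : hom L K) : are_inverse f g ->
  cancel (on_edges f) (on_edges g) /\ cancel (on_edges g) (on_edges f).
Proof. by case/(@tree_iso_gen (repr_tree K) (repr_tree L)). Qed.

(** An isomorphism of tree operads preserves vertices, hence comes from an isomorphism of planar
trees, and objects are isomorphism classes of planar trees. *)
Lemma Omega_skeletal K L (f : hom K L) : is_isom f -> K = L.
Proof.
move=> fi; have iso_trans (A B C : planar_tree) : isomorphic A B -> isomorphic B C -> isomorphic A C.
  move=> /tree_operad_iso[u ui] /tree_operad_iso[v vi].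
  apply: (@tree_iso_isomorphic A C (@mcomp Op_ns _ _ _ v u)); exact: mcomp_isom.
have iso_sym (A B : planar_tree) : isomorphic A B -> isomorphic B A.
  by move=> /tree_operad_iso[u [v [vu uv]]]; apply: (@tree_iso_isomorphic B A v); exists u.
have KL : isomorphic (repr_tree K) (repr_tree L) := tree_iso_isomorphic fi.
have reprE (X : tree_class) : sval X = isomorphic (repr_tree X) := svalP (cid (svalP X)).
have e : sval K = sval L.
  rewrite !reprE; apply/funext => T; apply: propext; split; apply: iso_trans => //.
  exact: iso_sym.
have sval_inj (X Y : tree_class) : sval X = sval Y -> X = Y.
  by case: X Y => [X hX] [Y hY] /= XY; apply: eq_exist.
exact: sval_inj.
Qed.

Lemma Omega_rigid K (f : hom K K) : is_isom f -> f = idm K.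
Proof. exact: tree_auto_id. Qed.

End OnEdges.

(** The representative of the class of a tree is isomorphic to it and inherits its labels. *)
Lemma parent_tree_class N q leaf : (forall j, 0 < j -> q j < j) ->
  (forall j, 0 < j <= N -> ~~ leaf (q j)) ->
  exists (K : Omega_ns) (lab : nat -> edges K),
  [/\ {in [pred i | i <= N] &, injective lab},
      forall e, exists2 i, i <= N & e = lab i &
      forall s e, Gen s e <-> exists2 i, i <= N /\ ~~ leaf i &
        e = lab i /\ s = map lab (children N q i)].
Proof.
move=> qlt qleaf; pose T := parent_planar qlt qleaf; exists (class_of T).
have [f [g fg]] := tree_operad_iso (repr_class_of T).
have [fK gK fG] := tree_iso_gen fg.
have [|_ _ gG] := @tree_iso_gen _ _ g f; first by case: fg.
exists (fun j => cmap f (plabel qlt qleaf j)); split.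
- move=> i j; rewrite !inE => iN jN /(can_inj fK); exact: plabel_inj.
- move=> e; have [i iN eE] := plabel_surj (cmap g e); exists i => //.
  by rewrite -eE gK.
- move=> s e; split=> [/gG/parent_gen[i iP [eE sE]]|[i iP [-> ->]]].
    exists i => //; rewrite -[e]gK eE; split=> //.
    by rewrite map_comp -sE -map_comp -[LHS]map_id; apply: eq_map => x /=; rewrite gK.
  by rewrite map_comp; apply: fG; apply/parent_gen; exists i.
Qed.

Definition is_corolla (K : Omega_ns) (r : edges K) (xs : seq (edges K)) : Prop :=
  [/\ uniq (r :: xs), forall e, e \in r :: xs & forall s c, Gen s c <-> s = xs /\ c = r].

Lemma eta_ex : exists K : Omega_ns, (exists e : edges K, forall x, x = e) /\
  forall s c, ~ @Gen K s c.
Proof.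
have [||K [lab [_ labS labG]]] := @parent_tree_class 0 predn predT.
- by case.
- by case.
exists K; split; first by exists (lab 0) => x; have [i] := labS x; rewrite leqn0 => /eqP->.
by move=> s c /labG[i []].
Qed.

Lemma corolla_ex n : exists (K : Omega_ns) r xs, @is_corolla K r xs /\ size xs = n.
Proof.
have [//|//|K [lab [labI labS labG]]] := @parent_tree_class n (fun _ => 0) (fun j => 0 < j).
have ch0 : children n (fun _ => 0) 0 = iota 1 n.
  by rewrite /children (eq_filter (a2 := predT)) ?filter_predT.
exists K, (lab 0), (map lab (iota 1 n)); split; last by rewrite size_map size_iota.
split.
- rewrite -(map_cons lab 0) -[0 :: iota 1 n]/(iota 0 n.+1) map_inj_in_uniq ?iota_uniq //.
  by move=> i j; rewrite !mem_iota !add0n !ltnS; apply: labI.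
- move=> e; have [i iN ->] := labS e; rewrite -(map_cons lab 0).
  by apply: (map_f lab); rewrite -[0 :: iota 1 n]/(iota 0 n.+1) mem_iota.
- move=> s c; split=> [/labG[i [_]]|[-> ->]].
    by rewrite -eqn0Ngt => /eqP-> [-> ->]; rewrite ch0.
  by apply/labG; exists 0 => //; rewrite ch0.
Qed.

(** A binary vertex with an [n]-ary vertex grafted onto its first or second input. *)
Lemma graft_ex n (second : bool) : exists (K : Omega_ns) a b c ds,
  [/\ size ds = n, uniq [:: c, a, b & ds], @Gen K [:: a; b] c &
      Gen ds (if second then b else a)].
Proof.
pose k := if second then 2 else 1; have k12 : 0 < k <= 2 by rewrite /k; clear; case: second.
pose q j := if j <= 2 then 0 else k.
have qlt j : 0 < j -> q j < j.
  move=> j0; rewrite /q; case: (leqP j 2) => // j2; apply: leq_ltn_trans j2; by case/andP: k12.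
have [//||K [lab [labI labS labG]]] := @parent_tree_class n.+2 q (fun j => (j != 0) && (j != k)).
  by move=> j _; rewrite /q; case: ifP => _; rewrite ?eqxx ?andbF.
have ch : iota 1 n.+2 = [:: 1, 2 & iota 3 n] by [].
have ch0 : children n.+2 q 0 = [:: 1; 2].
  rewrite /children ch /= -[RHS]cats0 -[filter _ _]/([::] ++ _) /=; congr [:: _, _ & _].
  apply/eqP; rewrite -[_ == _]negbK -has_filter; apply/hasPn => j; rewrite mem_iota /q.
  by case: (leqP j 2) => //= _ _; rewrite -lt0n; case/andP: k12.
have chk : children n.+2 q k = iota 3 n.
  have k0 : (0 == k) = false by apply/negbTE; rewrite eq_sym -lt0n; case/andP: k12.
  rewrite /children ch /= /q /= !k0; apply/all_filterP/allP => j.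
  by rewrite mem_iota; case: (leqP j 2) => //= _ _.
exists K, (lab 1), (lab 2), (lab 0), (map lab (iota 3 n)); split.
- by rewrite size_map size_iota.
- rewrite -[_ :: _]/(map lab (iota 0 n.+3)) map_inj_in_uniq ?iota_uniq //.
  by move=> i j; rewrite !mem_iota !add0n !ltnS; apply: labI.
- by apply/labG; exists 0; rewrite ?ch0.
- apply/labG; exists k; first by rewrite eqxx andbF;
  split=> //; apply: leq_trans (isT : 2 <= n.+2); case/andP: k12.
  by rewrite chk /k (fun_if lab).
Qed.

Lemma Opr_graft_left K (a b c : edges K) ds : a != b -> Opr [:: a; b] c -> Opr ds a ->
  Opr (rcons ds b) c.
Proof.
move=> ab abc dsa.
have -> : rcons ds b = flatten [seq if e == a then ds else [:: e] | e <- [:: a; b]].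
  by rewrite /= eqxx eq_sym (negPf ab) cats0 cats1.
by apply: opr_comp => // e _; case: eqP => [->|_] //; apply: opr_id.
Qed.

Lemma Opr_graft_right K (a b c : edges K) ds : a != b -> Opr [:: a; b] c -> Opr ds b ->
  Opr (a :: ds) c.
Proof.
move=> ab abc dsb.
have -> : a :: ds = flatten [seq if e == b then ds else [:: e] | e <- [:: a; b]].
  by rewrite /= eqxx (negPf ab) cats0.
by apply: opr_comp => // e _; case: eqP => [->|_] //; apply: opr_id.
Qed.

(** This asymmetry of binary vertices separates the identity from the mirror functor. *)
Lemma Opr_no_swap K (x y c : edges K) : x <> y -> Opr [:: x; y] c -> ~ Opr [:: y; x] c.
Proof.
move=> xy xyc yxc; have [] : [:: x; y] = [:: y; x]; last by [].
by apply: (opr_inj (Gen_tree K) xyc yxc); apply/perm_mem; rewrite (perm_catC [:: x] [:: y]).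
Qed.

(** * Equivalences and isomorphic functors *)

Section Generic.
Variables C D : category.

Lemma isom_epi (x y z : C) (f : hom x y) (g h : hom y z) :
  is_isom f -> mcomp g f = mcomp h f -> g = h.
Proof.
case=> f' [_ ff'] /(congr1 (fun u => mcomp u f')).
by rewrite -!mcomp_assoc ff' !mcomp_idr.
Qed.

Lemma isom_mono (x y z : C) (f : hom y z) (g h : hom x y) :
  is_isom f -> mcomp f g = mcomp f h -> g = h.
Proof.
case=> f' [f'f _] /(congr1 (fun u => mcomp f' u)).
by rewrite !mcomp_assoc f'f !mcomp_idl.
Qed.

Lemma faithful_of_inverse (F : functor C D) (G : functor D C) (x y : C) (f g : hom x y) :
  naturally_isomorphic (functor_comp G F) (functor_id C) -> fmor F f = fmor F g -> f = g.
Proof.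
case=> a ai Ffg; apply: (isom_epi (ai x)).
by rewrite -[f]/(fmor (functor_id C) f) -[g]/(fmor (functor_id C) g) -!ntcomp_nat /= Ffg.
Qed.

End Generic.

Lemma equivalence_faithful (C D : category) (F : functor C D) : is_equivalence F ->
  forall x y (f g : hom x y), fmor F f = fmor F g -> f = g.
Proof. by case=> G [GF _] x y f g Ffg; exact: (faithful_of_inverse GF Ffg). Qed.

Lemma equivalence_full (C D : category) (F : functor C D) : is_equivalence F ->
  forall x y (h : hom (F x) (F y)), exists f : hom x y, fmor F f = h.
Proof.
case=> G [[a ai] GF] x y h; have [ax' [ax1 ax2]] := ai x.
exists (mcomp (a y) (mcomp (fmor G h) ax')).
apply: (faithful_of_inverse GF); apply: (isom_mono (ai y)).
have := ntcomp_nat a (mcomp (a y) (mcomp (fmor G h) ax')) => /= ->.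
by rewrite -!mcomp_assoc ax1 mcomp_idr.
Qed.

Lemma equivalence_surj (C D : category) (F : functor C D) : is_equivalence F ->
  forall y, exists x (f : hom (F x) y), is_isom f.
Proof. by case=> G [_ [b bi]] y; exists (G y), (b y); exact: bi. Qed.

(** Once the objects are known to be equal, the components of the isomorphism are automorphisms, hence
identities, and naturality identifies the morphisms. *)
Lemma natiso_eq (C D : category) (F G : functor C D) :
  (forall (x y : D) (f : hom x y), is_isom f -> x = y) ->
  (forall (x : D) (f : hom x x), is_isom f -> f = idm x) ->
  naturally_isomorphic F G -> F = G.
Proof.
move=> skel rigid [a ai].
have arr_eq (x x' y y' : D) (u : hom x x') (v : hom y y') (f : hom x y) (g : hom x' y') :
    is_isom u -> is_isom v -> mcomp v f = mcomp g u -> arr f = arr g.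
  move=> ui vi; have ex := skel _ _ _ ui; have ey := skel _ _ _ vi; subst x' y'.
  by rewrite (rigid _ _ ui) (rigid _ _ vi) mcomp_idl mcomp_idr => ->.
apply: functor_eq => [|x y f]; first by apply/funext => x; apply: skel (ai x).
by apply: arr_eq (ai x) (ai y) _; apply: ntcomp_nat.
Qed.

Lemma Omega_natiso_eq (F G : functor Omega_ns Omega_ns) : naturally_isomorphic F G -> F = G.
Proof. by apply: natiso_eq; [apply: Omega_skeletal | apply: Omega_rigid]. Qed.

(** Naturality and invertibility can be checked on edges, since maps of trees are determined by their
effect on edges. *)
Lemma natiso_of_edges (F G : functor Omega_ns Omega_ns) (phi : forall K, edges (F K) -> edges (G K))
    (psi : forall K, edges (G K) -> edges (F K)) :
  (forall K, cancel (phi K) (psi K)) -> (forall K, cancel (psi K) (phi K)) ->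
  (forall K s c, Opr s c <-> Opr (map (phi K) s) (phi K c)) ->
  (forall K L (f : hom K L) e, phi L (on_edges (fmor F f) e) = on_edges (fmor G f) (phi K e)) ->
  F = G.
Proof.
move=> pq qp pO pN; apply: Omega_natiso_eq.
have a_ex K : exists f : hom (F K) (G K), on_edges f = phi K.
  by apply: on_edges_ex => s c /opr_gen; apply: (proj1 (pO K s c)).
pose a K := sval (cid (a_ex K)).
have aE K : on_edges (a K) = phi K by exact: (svalP (cid (a_ex K))).
have bE K : exists f : hom (G K) (F K), on_edges f = psi K.
  apply: on_edges_ex => s c /opr_gen sc; apply/pO; rewrite qp -map_comp.
  by rewrite (eq_map (g := id)) ?map_id // => e; apply: qp.
have a_nat K L (f : hom K L) : mcomp (a L) (fmor F f) = mcomp (fmor G f) (a K).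
  by apply: on_edges_inj => e; rewrite !on_edges_comp !aE pN.
exists (NatTrans a_nat) => K /=; have [b bK] := bE K; exists b.
by split; apply: on_edges_inj => e; rewrite on_edges_comp aE bK; [apply: pq | apply: qp].
Qed.

(** * The action of an autoequivalence on edges and operations *)

(** The tree with one edge and no vertex. Its maps to a tree [K] are the edges of [K]. *)
Definition eta : Omega_ns := sval (cid eta_ex).
Definition eta_edge : edges eta := sval (cid (proj1 (svalP (cid eta_ex)))).

Lemma eta_edgeE (e : edges eta) : e = eta_edge.
Proof. exact: (svalP (cid (proj1 (svalP (cid eta_ex)))) e). Qed.

Lemma eta_Gen s c : ~ @Gen eta s c.
Proof. exact: (proj2 (svalP (cid eta_ex)) s c). Qed.

Lemma eta_Opr s c : @Opr eta s c -> s = [:: c].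
Proof. by case/opr_inv => // -[t [f [/eta_Gen]]]. Qed.

Lemma point_ex K (e : edges K) : exists f : hom eta K, on_edges f = fun _ => e.
Proof. by apply: on_edges_ex => s c /eta_Gen. Qed.

Definition point K (e : edges K) : hom eta K := sval (cid (point_ex e)).

Lemma pointE K (e : edges K) x : on_edges (point e) x = e.
Proof. by rewrite /point; case: cid => f /= ->. Qed.

Lemma edges_inh K : exists e : edges K, True.
Proof. by have [r _] := vtx_root (Gen_tree K); exists r. Qed.

(** A tree maps to [eta] if and only if all its vertices are unary. *)
Definition linear (X : Omega_ns) := exists f : hom X eta, True.

Lemma linear_Gen X s c : linear X -> @Gen X s c -> size s = 1.
Proof.
by case=> f _ /opr_gen /(on_edges_Opr f) /eta_Opr /(congr1 size); rewrite size_map.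
Qed.

Lemma linear_of_Gen X : (forall s c, @Gen X s c -> size s = 1) -> linear X.
Proof.
move=> h; have [f _] : exists f : hom X eta, on_edges f = fun _ => eta_edge.
  by apply: on_edges_ex => s c /h; case: s => [|x [|]] //= _; apply: opr_id.
by exists f.
Qed.

(** Corollas represent operations. *)
Lemma corolla_map K r xs L s c : @is_corolla K r xs -> @Opr L s c -> size s = size xs ->
  exists f : hom K L, on_edges f r = c /\ map (on_edges f) xs = s.
Proof.
move=> [/= /andP[rxs uxs] allK genK] sc ss.
pose h e := if e == r then c else nth c s (index e xs).
have hxs : map h xs = s.
  apply: (@eq_from_nth _ c); rewrite size_map // => i ixs.
  rewrite (nth_map r) // /h index_uniq //; case: eqP => // xr.
  by rewrite -xr mem_nth in rxs.
have hr : h r = c by rewrite /h eqxx.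
have [f fE] : exists f : hom K L, on_edges f = h.
  by apply: on_edges_ex => s' c' /genK[-> ->]; rewrite hxs hr.
by exists f; rewrite fE.
Qed.

(** This condition is invariant under equivalences. It says that no map into [K] singles out a proper
part of [K] containing a vertex; linear trees have to be allowed since their vertices can be
collapsed to an edge. *)
Definition corolla_like (K : Omega_ns) : Prop := forall X (f : hom X K),
  (forall e, exists x, on_edges f x = e) \/
  ((forall x y, on_edges f x = on_edges f y) /\ linear X).

(** If some vertex of [X] goes to the vertex of the corolla, all edges are reached; otherwise each
vertex of [X] goes to an identity, hence is unary with the same image for its input and output. *)
Lemma is_corolla_like K r xs : @is_corolla K r xs -> corolla_like K.
Proof.
move=> [/= /andP[rxs uxs] allK genK] X f.
have [[s [c [Gs fs]]]|nG] := pselect (exists s c, Gen s c /\ map (on_edges f) s <> [:: on_edges f c]).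
  left => e; have [//|[t [g [/genK[-> cr] gP fsE]]]] := opr_inv (on_edges_Opr f (opr_gen Gs)).
  have gx x : x \in xs -> g x = [:: x].
    move=> xxs; have [//|[t' [g' [/genK[_ xr]]]]] := opr_inv (gP x xxs).
    by rewrite -xr xxs in rxs.
  have {}fsE : map (on_edges f) s = xs.
    by rewrite fsE -[RHS]flatten_id; congr flatten; apply/eq_in_map.
  have := allK e; rewrite inE => /predU1P[->|]; first by exists c.
  by rewrite -fsE => /mapP[x _ ->]; exists x.
have {}nG s c : Gen s c -> map (on_edges f) s = [:: on_edges f c].
  by move=> Gs; apply: contrapT => h; apply: nG; exists s, c.
right; split; last by apply: linear_of_Gen => s c /nG /(congr1 size); rewrite size_map.
have [r' [_ rE]] := vtx_root (Gen_tree X); have [d dP] := vtx_depth (Gen_tree X).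
suff fr x : on_edges f x = on_edges f r' by move=> x y; rewrite !fr.
have [n] := ubnP (d x); elim: n x => // n IH x xn.
have [->//|[s [c [Gs xs']]]] := rE x.
rewrite -(IH c); last by move: xn; rewrite (dP _ _ _ Gs xs').
by apply/eqP; rewrite -mem_seq1 -(nG _ _ Gs) map_f.
Qed.

(** The edges of any vertex are the image of a map from a corolla, so each vertex has to meet all
edges; two such vertices would lie above each other. *)
Lemma corolla_like_Gen K t c : corolla_like K -> @Gen K t c -> is_corolla c t.
Proof.
move=> KQ Gt; have ct : c \notin t.
  by apply/negP => /(vtx_notin (Gen_tree K) Gt); apply; apply: below_refl.
have allK (s' : seq (edges K)) c' : Gen s' c' -> forall e, e \in c' :: s'.
  move=> Gs' e; have [X [r [xs [Xc sX]]]] := corolla_ex (size s').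
  have [f [fr fxs]] := corolla_map Xc (opr_gen Gs') (esym sX).
  case: (Xc) => _ allX genX; case: (KQ X f) => [/(_ e)[x <-]|[fc lX]].
    have := allX x; rewrite inE => /predU1P[->|xxs]; first by rewrite fr mem_head.
    by rewrite inE -fxs map_f ?orbT.
  have : size xs = 1 by apply: (linear_Gen lX); apply/genX.
  case: (xs) fxs => [|x [|]] //= fx _.
  have cs' : c' \in s' by rewrite -fx mem_seq1 -fr (fc x r).
  by case: (vtx_notin (Gen_tree K) Gs' cs'); apply: below_refl.
split; first by rewrite /= ct (vtx_uniq (Gen_tree K) Gt).
- exact: allK.
- move=> s' c'; split=> [Gs'|[-> ->] //].
  have cc' : c' = c.
    apply: (below_anti (Gen_tree K)); first exact: (opr_below (opr_gen Gt) (allK _ _ Gt _)).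
    exact: (opr_below (opr_gen Gs') (allK _ _ Gs' _)).
  by subst c'; split=> //; apply: vtx_fun (Gen_tree K) _ _ _ Gs' Gt.
Qed.

Section Equivalence.
Variable F : functor Omega_ns Omega_ns.
Hypothesis Feq : is_equivalence F.

Let full := equivalence_full Feq.
Let faithful := equivalence_faithful Feq.
Let esurj := equivalence_surj Feq.

Lemma F_eta_map K : exists f : hom (F eta) K, True.
Proof.
have [X [a _]] := esurj K; have [e _] := edges_inh X.
by exists (mcomp a (fmor F (point e))).
Qed.

(** Like [eta], its image maps to every tree and has no endomorphism but the identity. The identity
therefore factors through a point. *)
Lemma F_eta_single (x y : edges (F eta)) : x = y.
Proof.
have [a _] := F_eta_map eta.
have end1 (f : hom (F eta) (F eta)) : f = idm _.
  have [g <-] := full f; suff -> : g = idm eta by rewrite fmor_id.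
  by apply: on_edges_inj => e; rewrite [LHS]eta_edgeE [RHS]eta_edgeE.
have e (z : edges (F eta)) : z = x.
  rewrite -[z]/(on_edges (idm (F eta)) z) -(end1 (mcomp (point x) a)).
  by rewrite on_edges_comp pointE.
by rewrite [y]e.
Qed.

Definition F_eta_edge : edges (F eta) := sval (cid (edges_inh (F eta))).

(** As the edges of [K] are the maps from [eta], and [F eta] has the same maps out of it as [eta],
the functor transports edges of [K] to edges of [F K]. *)
Definition gamma K (e : edges K) : edges (F K) := on_edges (fmor F (point e)) F_eta_edge.

Lemma gamma_nat K L (f : hom K L) e : gamma (on_edges f e) = on_edges (fmor F f) (gamma e).
Proof.
rewrite /gamma -on_edges_comp -fmor_comp; congr (on_edges (fmor F _) _).
by apply: on_edges_inj => x; rewrite on_edges_comp !pointE.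
Qed.

Lemma map_gamma_nat K L (f : hom K L) s :
  map (@gamma L) (map (on_edges f) s) = map (on_edges (fmor F f)) (map (@gamma K) s).
Proof. by rewrite -!map_comp; apply: eq_map => e /=; rewrite gamma_nat. Qed.

Lemma gamma_inj K : injective (@gamma K).
Proof.
move=> e e' ee'; rewrite -(pointE e eta_edge) -(pointE e' eta_edge).
congr (on_edges _ _); apply: faithful; apply: on_edges_inj => x.
by rewrite (F_eta_single x F_eta_edge).
Qed.

Lemma gamma_surj K (x : edges (F K)) : exists e, gamma e = x.
Proof.
have [a _] := F_eta_map eta; have [g gE] := full (mcomp (point x) a).
exists (on_edges g eta_edge).
rewrite gamma_nat (F_eta_single (gamma _) F_eta_edge) gE on_edges_comp; exact: pointE.
Qed.

Lemma linear_F K : linear K <-> linear (F K).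
Proof.
have [a _] := F_eta_map eta; have [b _] := point_ex F_eta_edge.
split=> [[f _]|[f _]]; first by exists (mcomp a (fmor F f)).
by have [g _] := full (mcomp b f); exists g.
Qed.

Lemma corolla_like_F K : corolla_like K -> corolla_like (F K).
Proof.
move=> KQ X' f'; have [X [a ai]] := esurj X'; have [f fE] := full (mcomp f' a).
have [b ab] := ai; have [_ bK] := on_edges_inverse ab.
have f'E x : on_edges f' (on_edges a (gamma x)) = gamma (on_edges f x).
  by rewrite -on_edges_comp -fE gamma_nat.
case: (KQ X f) => [fs|[fc lX]]; [left => e | right; split].
- have [k <-] := gamma_surj e; have [x <-] := fs k.
  by exists (on_edges a (gamma x)).
- suff fb x : exists z, on_edges f' x = gamma (on_edges f z).
    by move=> x y; have [z ->] := fb x; have [z' ->] := fb y; rewrite (fc z z').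
  by have [z zE] := gamma_surj (on_edges b x); exists z; rewrite -f'E zE bK.
- by have [g _] := (proj1 (linear_F X)) lX; exists (mcomp g b).
Qed.

(** The image satisfies the condition that characterizes corollas, and it has a vertex: otherwise it
would have only one edge and [K] would be linear. At this stage any edge might be its root. *)
Lemma F_corolla K r xs : @is_corolla K r xs -> exists c t, @is_corolla (F K) c t /\
  perm_eq (c :: t) (map (@gamma K) (r :: xs)).
Proof.
move=> Kc; have [uK allK genK] := Kc; have DQ := corolla_like_F (is_corolla_like Kc).
suff [t [c Gt]] : exists t c, @Gen (F K) t c.
  have Dc := corolla_like_Gen DQ Gt; exists c, t; split=> //; have [uD allD _] := Dc.
  apply: uniq_perm => //; first by rewrite map_inj_uniq //; apply: gamma_inj.
  by move=> x; rewrite allD; have [e <-] := gamma_surj x; rewrite map_f.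
apply: contrapT => nG.
have : linear K by apply/linear_F/linear_of_Gen => s c Gs; case: nG; exists s, c.
move=> /linear_Gen/(_ (proj2 (genK xs r) (conj erefl erefl))) sxs.
have [r' [_ rE]] := vtx_root (Gen_tree (F K)).
have single (e : edges (F K)) : e = r'.
  by have [//|[s [c [Gs _]]]] := rE e; case: nG; exists s, c.
case: xs sxs uK {Kc allK genK} => [|x [|]] //= _; rewrite inE andbT => /negP; apply.
by apply/eqP/gamma_inj; rewrite (single (gamma r)) (single (gamma x)).
Qed.

(** Corollas represent operations, so this property only depends on the image of the corolla with [n]
inputs. *)
Definition preserves (b : bool) (n : nat) : Prop := forall K (s : seq (edges K)) c,
  size s = n -> Opr s c <-> Opr (rev_if b (map (@gamma K) s)) (gamma c).

Lemma corolla_preserves b K r xs : @is_corolla K r xs ->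
  @is_corolla (F K) (gamma r) (rev_if b (map (@gamma K) xs)) -> preserves b (size xs).
Proof.
move=> Kc FKc L s c ss; have [_ _ genK] := Kc; have [_ _ genFK] := FKc.
have Kop : @Opr K xs r by apply: opr_gen; apply/genK.
have FKop : Opr (rev_if b (map (@gamma K) xs)) (gamma r) by apply: opr_gen; apply/genFK.
split=> sc.
  have [f [<- <-]] := corolla_map Kc sc ss.
  by rewrite map_gamma_nat gamma_nat -map_rev_if; apply: on_edges_Opr.
have [|g [gr gs]] := corolla_map FKc sc; first by rewrite !size_rev_if !size_map.
have [f fE] := full g; move: gr gs; rewrite -fE -gamma_nat map_rev_if -map_gamma_nat.
by move=> /gamma_inj <- /rev_if_inj/(inj_map (@gamma_inj L)) <-; apply: on_edges_Opr.
Qed.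

Lemma preserves0 b : preserves b 0.
Proof.
have [K [r [xs [Kc /size0nil xs0]]]] := corolla_ex 0; subst xs.
have [c [t [FKc cr]]] := F_corolla Kc.
move: (perm_size cr) FKc => /=; case: t cr => // cr _.
have /perm_mem/(_ c) := cr; rewrite !inE eqxx => /esym/eqP -> FKc.
by apply: (corolla_preserves (b := b) Kc); case: b.
Qed.

(** Up to the unknown choice of the root and of the order of the inputs, operations are preserved. *)
Lemma F_Opr K s c : @Opr K s c -> exists s' c', @Opr (F K) s' c' /\
  perm_eq (c' :: s') (map (@gamma K) (c :: s)).
Proof.
move=> sc; have [X [r [xs [Xc sX]]]] := corolla_ex (size s).
have [f [fr fxs]] := corolla_map Xc sc (esym sX).
have [c0 [t0 [FXc p0]]] := F_corolla Xc; have [_ _ genFX] := FXc.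
exists (map (on_edges (fmor F f)) t0), (on_edges (fmor F f) c0); split.
  by apply/on_edges_Opr/opr_gen/genFX.
by rewrite -map_cons -fr -fxs -(map_cons (on_edges f)) map_gamma_nat; apply: perm_map.
Qed.

(** If an input became the root of the image of the binary corolla, grafting a second binary vertex
onto the other input would give a tree whose image contains two pairs of nested edges among the
four outer edges, which support an operation; only its root can lie above another one. *)
Lemma F_corolla2_root K r x1 x2 c t : @is_corolla K r [:: x1; x2] -> @is_corolla (F K) c t ->
  perm_eq (c :: t) (map (@gamma K) [:: r; x1; x2]) -> c = gamma r.
Proof.
move=> Kc FKc pct; have [uFK allFK genFK] := FKc.
have le L (a b d : edges L) : Opr [:: a; b] d -> exists f : edges (F K) -> edges (F L),
    [/\ f (gamma r) = gamma d, f (gamma x1) = gamma a, f (gamma x2) = gamma b &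
        forall e, below (@Gen (F L)) (f e) (f c)].
  move=> abd; have [//|f [fr [fx1 fx2]]] := corolla_map Kc abd.
  exists (on_edges (fmor F f)); rewrite -!gamma_nat fr fx1 fx2; split=> // e.
  apply: (@opr_below _ _ (map (on_edges (fmor F f)) t)).
    by apply/on_edges_Opr/opr_gen/genFK.
  by rewrite -map_cons map_f.
have := mem_head c t; rewrite (perm_mem pct) !inE => /or3P[/eqP//|/eqP cx|/eqP cx]; exfalso.
  (* [x1] becomes the root: the second vertex is grafted onto [b], and [d] and [d2] end up below
     [a] and [d1] *)
  have [L [a [b [d [ds [sds u Gd Gds]]]]]] := graft_ex 2 true.
  case: ds sds u Gds => [|d1 [|d2 []]] // _ u Gds.
  have ab : a != b by case/and3P: u => _ /[!inE] /norP[].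
  have [s' [c' [s'c' ps]]] := F_Opr (Opr_graft_right ab (opr_gen Gd) (opr_gen Gds)).
  have [f [fr f1 f2 fle]] := le _ _ _ _ (opr_gen Gd).
  have [g [gr g1 g2 gle]] := le _ _ _ _ (opr_gen Gds).
  apply: (opr_no_two_below (Gen_tree (F L)) (@gamma_inj L) s'c' ps (p := d) (q := a) (p' := d2) (q' := d1)).
  - exact: (mask_uniq u [:: true; true; false; true; true]).
  - by rewrite (perm_cat2l [:: d; a] [:: d1; d2] [:: d2; d1]) (perm_catC [:: d1] [:: d2]).
  - by rewrite -fr -f1 -cx; apply: fle.
  - by rewrite -g2 -g1 -cx; apply: gle.
(* [x2] becomes the root: the second vertex is grafted onto [a], and [d] and [d1] end up below
   [b] and [d2] *)
have [L [a [b [d [ds [sds u Gd Gds]]]]]] := graft_ex 2 false.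
case: ds sds u Gds => [|d1 [|d2 []]] // _ u Gds.
have ab : a != b by case/and3P: u => _ /[!inE] /norP[].
have [s' [c' [s'c' ps]]] := F_Opr (Opr_graft_left ab (opr_gen Gd) (opr_gen Gds)).
have [f [fr f1 f2 fle]] := le _ _ _ _ (opr_gen Gd).
have [g [gr g1 g2 gle]] := le _ _ _ _ (opr_gen Gds).
apply: (opr_no_two_below (Gen_tree (F L)) (@gamma_inj L) s'c' ps (p := d) (q := b) (p' := d1) (q' := d2)).
- rewrite -(perm_uniq (s1 := [:: d, b & [:: d1; d2]])).
    exact: (mask_uniq u [:: true; false; true; true; true]).
  by rewrite (perm_cat2l [:: d] [:: b; d1; d2] [:: d1; d2; b]) (perm_catC [:: b] [:: d1; d2]).
- by rewrite (perm_cat2l [:: d] [:: d1; d2; b] [:: b; d1; d2]) (perm_catC [:: d1; d2] [:: b]).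
- by rewrite -fr -f2 -cx; apply: fle.
- by rewrite -g1 -g2 -cx; apply: gle.
Qed.

Lemma preserves2 : exists b, preserves b 2.
Proof.
have [K [r [xs [Kc sxs]]]] := corolla_ex 2.
case: xs sxs Kc => [|x1 [|x2 []]] //= _ Kc.
have [c [t [FKc pct]]] := F_corolla Kc; have cE := F_corolla2_root Kc FKc pct; subst c.
rewrite perm_cons in pct; have [b tE] := perm_eq2 pct.
by exists b; rewrite tE in FKc; apply: corolla_preserves Kc FKc.
Qed.

(** Grafting an [n]-ary vertex onto a binary one gives an operation of arity [n.+1] whose image is
known from those of the two vertices. As an operation is determined by its output and its set of
inputs, this prescribes the image of the corolla with [n.+1] inputs. Starting from [n = 0] the step also
reaches arity 1, for which the two orientations of the linear tree would otherwise be hard to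
tell apart. *)
Lemma preservesS b n : preserves b 2 -> preserves b n -> preserves b n.+1.
Proof.
move=> P2 Pn; have [L [a [d [c [ds [sds u Gc Ga]]]]]] := graft_ex n false.
have ad : a != d by case/and3P: u => _ /[!inE] /norP[].
have op : Opr (rcons ds d) c := Opr_graft_left ad (opr_gen Gc) (opr_gen Ga).
have u' : uniq (c :: rcons ds d).
  move: u; rewrite /= rcons_uniq mem_rcons !inE !negb_or -!andbA.
  by move=> /and5P[_ -> -> _ /and3P[_ -> ->]].
have Fop : Opr (rev_if b (map (@gamma L) (rcons ds d))) (gamma c).
  have gad : gamma a != gamma d by rewrite (inj_eq (@gamma_inj L)).
  have := proj1 (P2 L [:: a; d] c erefl) (opr_gen Gc).
  have := proj1 (Pn L ds a sds) (opr_gen Ga).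
  rewrite map_rcons; case: (b) => /= h1 h2; last exact: Opr_graft_left h2 h1.
  by rewrite rev_rcons; apply: Opr_graft_right h2 h1; rewrite eq_sym.
have [K [r [xs [Kc sX]]]] := corolla_ex n.+1; rewrite -sX.
have sop : size (rcons ds d) = size xs by rewrite size_rcons sds sX.
have [f [fr fxs]] := corolla_map Kc op sop.
have [c0 [t0 [FKc p0]]] := F_corolla Kc; have [_ allK _] := Kc; have [_ _ genFK] := FKc.
have fK : uniq (map (on_edges f) (r :: xs)) by rewrite /= fr fxs.
have f_inj : injective (on_edges f).
  have aux (s : seq (edges K)) : uniq (map (on_edges f) s) -> {in s &, injective (on_edges f)}.
    elim: s => // z s IH /= /andP[zs us] x y; rewrite !inE => /predU1P[->|xs'] /predU1P[->|ys'] // e.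
    - by rewrite e map_f in zs.
    - by rewrite -e map_f in zs.
    - exact: IH.
  by move=> x y; apply: aux fK _ _ (allK x) (allK y).
have Ff_inj : injective (on_edges (fmor F f)).
  move=> x y; have [x' <-] := gamma_surj x; have [y' <-] := gamma_surj y.
  by rewrite -!gamma_nat => /gamma_inj/f_inj ->.
have p1 : perm_eq (on_edges (fmor F f) c0 :: map (on_edges (fmor F f)) t0)
    (gamma c :: map (@gamma L) (rcons ds d)).
  rewrite -map_cons -(map_cons (@gamma L)) -fr -fxs -(map_cons (on_edges f)) map_gamma_nat.
  exact: perm_map.
have u1 : uniq (gamma c :: map (@gamma L) (rcons ds d)).
  by rewrite -map_cons map_inj_uniq //; apply: gamma_inj.
have [||||] := opr_same_set (Gen_tree (F L)) _ Fop
  (s := map (on_edges (fmor F f)) t0) (c := on_edges (fmor F f) c0).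
- by apply/on_edges_Opr/opr_gen/genFK.
- by rewrite -(perm_uniq p1) in u1; case/andP: u1.
- by rewrite mem_rev_if; case/andP: u1.
- by move=> x; rewrite (perm_mem p1) !inE mem_rev_if.
rewrite -{1}fr gamma_nat => /Ff_inj cE.
rewrite -fxs map_gamma_nat -map_rev_if => /(inj_map Ff_inj) tE.
by rewrite cE tE in FKc; apply: corolla_preserves Kc FKc.
Qed.

Lemma F_direct_or_reversed : exists b, forall K (s : seq (edges K)) c,
  Opr s c <-> Opr (rev_if b (map (@gamma K) s)) (gamma c).
Proof.
have [b P2] := preserves2; exists b => K s c.
have Pn : forall n, preserves b n.
  by elim=> [|n IH]; [apply: preserves0 | apply: preservesS].
exact: Pn.
Qed.
End Equivalence.

(** * The mirror functor and the group of autoequivalences *)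

Section Mirror.
Implicit Types K L : Omega_ns.

Definition flip K : edges K -> edges (Omega_mirror K) := cmap (mirror_isom K).
Definition unflip K : edges (Omega_mirror K) -> edges K := cmap (sval (cid (mirror_isomP K))).

Lemma flipK K : cancel (@flip K) (@unflip K).
Proof.
move=> e; have [h _] := svalP (cid (mirror_isomP K)).
pose P := mirror_operad (tree_operad (repr_tree K)).
exact: (congr1 (fun f : operad_map P P => cmap f e) h).
Qed.

Lemma unflipK K : cancel (@unflip K) (@flip K).
Proof.
move=> e; have [_ h] := svalP (cid (mirror_isomP K)).
pose P := tree_operad (repr_tree (mirror_class K)).
exact: (congr1 (fun f : operad_map P P => cmap f e) h).
Qed.

Lemma mirror_on_edges K L (f : hom K L) e :
  on_edges (fmor Omega_mirror f) e = flip (on_edges f (unflip e)).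
Proof. by []. Qed.

Lemma unflip_Opr K s c : @Opr (Omega_mirror K) s c -> Opr (rev (map (@unflip K) s)) (unflip c).
Proof.
move=> /opr_op[x]; apply/opr_op; constructor.
exact: (Defs.omap (sval (cid (mirror_isomP K))) x).
Qed.

Lemma flip_Opr K s c : Opr s c -> Opr (rev (map (@flip K) s)) (flip c).
Proof.
rewrite -map_rev -{1}(revK s) => /opr_op[x]; apply/opr_op; constructor.
exact: (Defs.omap (mirror_isom K) (x : @op (mirror_operad (tree_operad (repr_tree K))) (rev s) c)).
Qed.

Lemma map_flipK K s : map (@unflip K) (map (@flip K) s) = s.
Proof. by rewrite -map_comp (eq_map (g := id)) ?map_id // => e; apply: flipK. Qed.

Lemma flip_OprE K s c : Opr s c <-> Opr (rev (map (@flip K) s)) (flip c).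
Proof.
split; first exact: flip_Opr.
by move=> /unflip_Opr; rewrite flipK map_rev revK map_flipK.
Qed.

Lemma unflip_OprE K s c : @Opr (Omega_mirror K) s c <-> Opr (rev (map (@unflip K) s)) (unflip c).
Proof.
split; first exact: unflip_Opr.
move=> /flip_Opr; rewrite unflipK map_rev revK -map_comp.
by rewrite (eq_map (g := id)) ?map_id // => e; apply: unflipK.
Qed.

Lemma mirror_involutive : functor_comp Omega_mirror Omega_mirror = functor_id Omega_ns.
Proof.
apply/esym/(@natiso_of_edges (functor_id Omega_ns) (functor_comp Omega_mirror Omega_mirror)
  (fun K e => flip (flip e)) (fun K e => unflip (unflip e))).
- by move=> K e; rewrite !flipK.
- by move=> K e; rewrite !unflipK.
- move=> K s c; rewrite flip_OprE [Opr (rev _) _]flip_OprE map_rev revK -map_comp.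
  by [].
- by move=> K L f e; rewrite !mirror_on_edges !flipK.
Qed.

Lemma mirror_equivalence : is_equivalence Omega_mirror.
Proof. by exists Omega_mirror; rewrite mirror_involutive; split; apply: nat_iso_refl. Qed.

End Mirror.

(** The transport of edges [gamma F] is an isomorphism from the identity, or from the mirror functor
after precomposition with [unflip]. *)
Lemma equivalence_id_or_mirror F : is_equivalence F ->
  F = functor_id Omega_ns \/ F = Omega_mirror.
Proof.
move=> Feq; pose g K (e : edges K) := gamma F e.
pose d K (x : edges (F K)) := sval (cid (gamma_surj Feq x)).
have dK K : cancel (@d K) (@g K) by move=> x; exact: (svalP (cid (gamma_surj Feq x))).
have gK K : cancel (@g K) (@d K) by move=> e; apply: (gamma_inj Feq); apply: dK.
have [[] Fb] := F_direct_or_reversed Feq; [right | left]; apply/esym.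
  apply: (@natiso_of_edges Omega_mirror F (fun K e => g K (unflip e)) (fun K e => flip (d K e))).
  - by move=> K e; rewrite gK unflipK.
  - by move=> K e; rewrite flipK dK.
  - by move=> K s c; rewrite unflip_OprE Fb /= map_rev revK -map_comp.
  - move=> K L f e; rewrite mirror_on_edges flipK; exact: gamma_nat.
apply: (@natiso_of_edges (functor_id Omega_ns) F g d) => //.
move=> K L f e; exact: gamma_nat.
Qed.

(** A natural transformation is determined by its component at the tree without vertices, since
every edge of [F K] is the image of a point of [K]. *)
Lemma nattrans_unique (F F' : functor Omega_ns Omega_ns) (a b : nattrans F F') :
  is_equivalence F -> is_equivalence F' -> a = b.
Proof.
move=> Feq F'eq; apply: nattrans_eq => K; apply: on_edges_inj => x.
have [e <-] := gamma_surj Feq x; rewrite /gamma -!on_edges_comp !ntcomp_nat !on_edges_comp.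
congr (on_edges _ _); exact: F_eta_single.
Qed.

Lemma no_nattrans_id_mirror : nattrans (functor_id Omega_ns) Omega_mirror -> False.
Proof.
move=> a; have [K [r [xs [Kc sxs]]]] := corolla_ex 2.
case: xs sxs Kc => [|x [|y []]] // _ [/= /and3P[_ + _] _ genK].
rewrite mem_seq1 => /eqP xy.
have aE e : on_edges (a K) e = flip e.
  rewrite -{1}(pointE e eta_edge) -on_edges_comp.
  by rewrite (ntcomp_nat a (point e)) on_edges_comp mirror_on_edges pointE.
have xyr : Opr [:: x; y] r by apply: opr_gen; apply/genK.
have := on_edges_Opr (a K) xyr; rewrite /= !aE; apply: Opr_no_swap (flip_Opr xyr).
by move=> /(can_inj (@flipK K)) /esym.
Qed.

Lemma no_nattrans_mirror_id : nattrans Omega_mirror (functor_id Omega_ns) -> False.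
Proof.
move=> a; have [K [r [xs [Kc sxs]]]] := corolla_ex 2.
case: xs sxs Kc => [|x [|y []]] // _ [/= /and3P[_ + _] _ genK].
rewrite mem_seq1 => /eqP xy.
have aE e : on_edges (a K) (flip e) = e.
  have -> : flip e = on_edges (fmor Omega_mirror (point e)) (flip eta_edge).
    by rewrite mirror_on_edges pointE.
  by rewrite -on_edges_comp (ntcomp_nat a (point e)) on_edges_comp pointE.
have xyr : Opr [:: x; y] r by apply: opr_gen; apply/genK.
have := on_edges_Opr (a K) (flip_Opr xyr); rewrite /= !aE.
exact: Opr_no_swap xyr.
Qed.

Lemma strict_monoidal_functor_eq (A B : strict_monoidal_category)
    (Phi Psi : strict_monoidal_functor A B) : smfun Phi = smfun Psi -> Phi = Psi.
Proof.
case: Phi Psi => [Phi u t m] [Psi u' t' m'] /= e; subst Psi.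
by rewrite (Prop_irrelevance u u') (Prop_irrelevance t t') (Prop_irrelevance m m').
Qed.
Section Assembly.
Import GRing.Theory.
Local Open Scope ring_scope.

(** Every equation between morphisms of [Aut Omega_ns] is therefore automatic, and only equations
between objects remain to be checked. *)
Lemma Aut_hom_irr (X Y : Aut Omega_ns) (a b : hom X Y) : a = b.
Proof. exact: (nattrans_unique a b (svalP X) (svalP Y)). Qed.

Lemma Aut_arr_eq (X Y X' Y' : Aut Omega_ns) (a : hom X Y) (b : hom X' Y') :
  X = X' -> Y = Y' -> arr a = arr b.
Proof. by move=> eX eY; subst X' Y'; rewrite (Aut_hom_irr a b). Qed.

Lemma Aut_eq (X Y : Aut Omega_ns) : underlying_functor X = underlying_functor Y -> X = Y.
Proof. exact: (@full_obj_eq (end_cat Omega_ns)). Qed.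

Definition Aut_id : Aut Omega_ns := tunit.
Definition Aut_mirror : Aut Omega_ns := exist _ Omega_mirror mirror_equivalence.

Lemma Aut_cases (X : Aut Omega_ns) : X = Aut_id \/ X = Aut_mirror.
Proof.
case: (equivalence_id_or_mirror (svalP X)) => h; [left | right]; exact: Aut_eq.
Qed.

Lemma Aut_hom_eq (X Y : Aut Omega_ns) : hom X Y -> X = Y.
Proof.
have [-> | ->] := Aut_cases X; have [-> | ->] := Aut_cases Y => // a.
- by case: (no_nattrans_id_mirror a).
- by case: (no_nattrans_mirror_id a).
Qed.

Lemma id_neq_mirror : Aut_id <> Aut_mirror.
Proof.
move=> h; apply: no_nattrans_id_mirror.
have : underlying_functor Aut_id = underlying_functor Aut_mirror by rewrite h.
by rewrite /= => <-; apply: nt_id.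
Qed.

Lemma Aut_mirror2 : ten Aut_mirror Aut_mirror = Aut_id.
Proof. by apply: Aut_eq; apply: mirror_involutive. Qed.

Lemma Z2_cases (x : 'Z_2) : x = 0 \/ x = 1.
Proof. by case: x => -[|[|]] // i; [left | right]; apply: val_inj. Qed.

Definition to_Aut (x : 'Z_2) : Aut Omega_ns := if x == 0 then Aut_id else Aut_mirror.

Definition to_Aut_mor (x y : disc_monoidal 'Z_2) (e : hom x y) : hom (to_Aut x) (to_Aut y) :=
  ecast z (hom (to_Aut x) (to_Aut z)) e (idm (to_Aut x)).

Definition to_Aut_functor : functor (disc_monoidal 'Z_2) (Aut Omega_ns) :=
  @Functor (disc_monoidal 'Z_2) (Aut Omega_ns) to_Aut to_Aut_mor
    (fun _ => Aut_hom_irr _ _) (fun _ _ _ _ _ => Aut_hom_irr _ _).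

Lemma to_Aut_add (x y : 'Z_2) : to_Aut (x + y) = ten (to_Aut x) (to_Aut y).
Proof.
have [-> | ->] := Z2_cases x; first by rewrite add0r [to_Aut 0]/= ten_unitl.
have [-> | ->] := Z2_cases y; first by rewrite addr0 [to_Aut 0]/= ten_unitr.
have -> : 1 + 1 = 0 :> 'Z_2 by apply: val_inj.
by rewrite [to_Aut 1]/= Aut_mirror2.
Qed.

Definition to_Aut_monoidal : strict_monoidal_functor (disc_monoidal 'Z_2) (Aut Omega_ns).
Proof.
refine (@StrictMonoidalFunctor (disc_monoidal 'Z_2) (Aut Omega_ns) to_Aut_functor erefl to_Aut_add _).
by move=> x x' y y' f g; apply: Aut_arr_eq; apply: to_Aut_add.
Defined.

Definition of_Aut (X : Aut Omega_ns) : 'Z_2 := if `[< X = Aut_id >] then 0 else 1.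

Lemma of_Aut_id : of_Aut Aut_id = 0. Proof. by rewrite /of_Aut asboolT. Qed.

Lemma of_Aut_mirror : of_Aut Aut_mirror = 1.
Proof. by rewrite /of_Aut asboolF // => /esym; apply: id_neq_mirror. Qed.

Lemma to_AutK (x : 'Z_2) : of_Aut (to_Aut x) = x.
Proof. by have [-> | ->] := Z2_cases x; [apply: of_Aut_id | apply: of_Aut_mirror]. Qed.

Lemma of_AutK X : to_Aut (of_Aut X) = X.
Proof. by have [-> | ->] := Aut_cases X; rewrite ?of_Aut_id ?of_Aut_mirror. Qed.

Lemma disc_hom_irr (x y : disc_cat 'Z_2) (f g : hom x y) : f = g.
Proof. exact: (@Prop_irrelevance (x = y :> 'Z_2) f g). Qed.

Definition of_Aut_functor : functor (Aut Omega_ns) (disc_monoidal 'Z_2) :=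
  @Functor (Aut Omega_ns) (disc_monoidal 'Z_2) of_Aut
    (fun X Y a => congr1 of_Aut (Aut_hom_eq a))
    (fun _ => disc_hom_irr _ _) (fun _ _ _ _ _ => disc_hom_irr _ _).

Lemma of_Aut_ten X Y : of_Aut (ten X Y) = of_Aut X + of_Aut Y.
Proof. by rewrite -{1}(of_AutK X) -{1}(of_AutK Y) -to_Aut_add to_AutK. Qed.

Definition of_Aut_monoidal : strict_monoidal_functor (Aut Omega_ns) (disc_monoidal 'Z_2).
Proof.
refine (@StrictMonoidalFunctor (Aut Omega_ns) (disc_monoidal 'Z_2) of_Aut_functor of_Aut_id of_Aut_ten _).
by move=> X X' Y Y' f g; apply: disc_arr_eq; apply: of_Aut_ten.
Defined.

Lemma to_Aut_isomorphism : is_monoidal_isomorphism to_Aut_monoidal.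
Proof.
exists of_Aut_monoidal; split.
  apply: functor_eq => [|x y f]; first by apply/funext => x; apply: to_AutK.
  by apply: disc_arr_eq; apply: to_AutK.
apply: functor_eq => [|x y f]; first by apply/funext => x; apply: of_AutK.
by apply: Aut_arr_eq; apply: of_AutK.
Qed.

End Assembly.

Theorem theorem6p5p4 :
  exists Phi : strict_monoidal_functor (disc_monoidal 'Z_2) (Aut Omega_ns),
    unique (fun Psi : strict_monoidal_functor (disc_monoidal 'Z_2) (Aut Omega_ns) =>
              underlying_functor (Psi (0%R : 'Z_2)) = functor_id Omega_ns /\
              underlying_functor (Psi (1%R : 'Z_2)) = Omega_mirror) Phi /\
    is_monoidal_isomorphism Phi.
Proof.
exists to_Aut_monoidal; split; last exact: to_Aut_isomorphism.
split=> [//|Psi [Psi0 Psi1]]; apply: strict_monoidal_functor_eq.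
have objE (x : 'Z_2) : to_Aut x = Psi x.
  by have [-> | ->] := Z2_cases x; apply: Aut_eq.
apply: functor_eq => [|x y f]; first by apply/funext.
exact: Aut_arr_eq.
Qed.
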